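(* Let $\mathsf{G} = \mathrm{Spec}\, A$ be an affine algebraic $\mathbb{R}$-group without imaginary connected components. For any linear representation $(E,\rho)$ of $\mathsf{G}$, the inclusion $E^{\mathsf{G}} \subseteq E^{\mathsf{G}(\mathbb{R})}$ is in fact an isomorphism of vector spaces: $$E^{\mathsf{G}} = E^{\mathsf{G}(\mathbb{R})}.$$
   Context: An affine algebraic $\mathbb{R}$-group is $\mathsf{G} = \mathrm{Spec}\, A$ with $A$ a finitely generated (commutative) Hopf $\mathbb{R}$-algebra. ''Without imaginary connected components'' means that each connected component of $\mathsf{G}$ has at least one rational point. $\mathsf{G}(\mathbb{R})$ denotes the set of rational points of $\mathsf{G}$; since $\mathsf{G}$ is smooth, it has a canonical structure of real Lie group. A linear representation of $\mathsf{G}$ is a finite dimensional $\mathbb{R}$-vector space $E$ together with a morphism of algebraic groups $\rho \colon \mathsf{G} \to \mathsf{Gl}(E)$, where $\mathsf{Gl}(E) = \mathrm{Spec}\, \mathbb{R}[x_{ij}]_{\det}$ is the affine $\mathbb{R}$-group of linear automorphisms of $E$; that is, a morphism of Hopf $\mathbb{R}$-algebras $\rho^* \colon \mathbb{R}[x_{ij}]_{\det} \to A$. It restricts to a representation of the Lie group $\mathsf{G}(\mathbb{R})$ on $E$. A vector $v \in E$ is $\mathsf{G}$-invariant if the algebraic morphism $\mathsf{G} \to E$, $g \mapsto \rho(g)(v)$ (a morphism of $\mathbb{R}$-schemes, where $E$ is regarded as an affine space over $\mathbb{R}$), is the constant map $v$. $E^{\mathsf{G}}$ is the vector space of $\mathsf{G}$-invariant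 vectors, and $E^{\mathsf{G}(\mathbb{R})} = \{ v \in E : \rho(g)(v) = v \text{ for all } g \in \mathsf{G}(\mathbb{R}) \}$. *)

(* Defs.v *)
From HB Require Import structures.
(* The notations of mpoly clash with those of the analysis libraries. *)
From mathcomp Require Import -(notations) mpoly.
From mathcomp Require Import all_boot all_order all_algebra.
From mathcomp Require Import generic_quotient ring_quotient ring.
From mathcomp Require Import boolp classical_sets reals topology.

Set Implicit Arguments.
Unset Strict Implicit.
Unset Printing Implicit Defensive.

Import GRing.Theory.
Local Open Scope classical_set_scope.
Local Open Scope quotient_scope.
Local Open Scope ring_scope.

(* A ⊗_K B is the quotient of the finite formal sums of pairs (a, b), encoded
   as sequences, identifying two sums that have the same image under every
   K-bilinear map. *)
Definition tsum (K : fieldType) (A B M : lmodType K) (f : A -> B -> M)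
  (s : seq (A * B)) : M := \sum_(p <- s) f p.1 p.2.

Definition is_bilinear (K : fieldType) (A B M : lmodType K) (f : A -> B -> M) :=
  (forall b, linear (f^~ b)) /\ (forall a, linear (f a)).

Section TensorDef.
Variables (K : fieldType) (A B : lmodType K).

Definition tequiv (s t : seq (A * B)) : bool :=
  `[< forall (M : lmodType K) (f : A -> B -> M),
        is_bilinear f -> tsum f s = tsum f t >].

Lemma tequiv_refl : reflexive tequiv.
Proof. by move=> s; apply/asboolP. Qed.

Lemma tequiv_sym : symmetric tequiv.
Proof.
by move=> s t; apply/asboolP/asboolP => H M f hf; rewrite H.
Qed.

Lemma tequiv_trans : transitive tequiv.
Proof.
move=> t s u /asboolP st /asboolP tu; apply/asboolP => M f hf.
by rewrite st // tu.
Qed.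

Canonical tequiv_equiv := EquivRel tequiv tequiv_refl tequiv_sym tequiv_trans.

Definition tensor : Type := {eq_quot tequiv}.
HB.instance Definition _ := Choice.on tensor.
HB.instance Definition _ := EqQuotient.on tensor.

End TensorDef.

Notation "A ⊗ B" := (tensor A B) (at level 40, left associativity) : type_scope.

Section TensorModule.
Variables (K : fieldType) (A B : lmodType K).
Implicit Types (x y z : A ⊗ B) (s t : seq (A * B)).

(* the linear map A ⊗ B -> M induced by f : A -> B -> M; only meaningful when
   f is bilinear *)
Definition tlift (M : lmodType K) (f : A -> B -> M) (x : A ⊗ B) : M :=
  tsum f (repr x).

Definition tens (a : A) (b : B) : A ⊗ B := \pi_(A ⊗ B) [:: (a, b)].

Lemma tlift_pi (M : lmodType K) (f : A -> B -> M) s :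
  is_bilinear f -> tlift f (\pi_(A ⊗ B) s) = tsum f s.
Proof.
move=> hf; rewrite /tlift; case: piP => t /eqmodP/asboolP H.
by rewrite H.
Qed.

Lemma tliftE (M : lmodType K) (f : A -> B -> M) a b :
  is_bilinear f -> tlift f (tens a b) = f a b.
Proof. by move=> hf; rewrite tlift_pi // /tsum big_seq1. Qed.

Lemma tensorP x y :
  (forall (M : lmodType K) (f : A -> B -> M),
     is_bilinear f -> tlift f x = tlift f y) -> x = y.
Proof.
move=> H; rewrite -[x]reprK -[y]reprK; apply/eqmodP/asboolP => M f hf.
exact: H.
Qed.

Section Bilinear.
Variables (M : lmodType K) (f : A -> B -> M).
Hypothesis hf : is_bilinear f.

Lemma bilinDl a a' b : f (a + a') b = f a b + f a' b.
Proof. by have := hf.1 b 1 a a'; rewrite /= !scale1r. Qed.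
Lemma bilinDr a b b' : f a (b + b') = f a b + f a b'.
Proof. by have := hf.2 a 1 b b'; rewrite /= !scale1r. Qed.
Lemma bilin0l b : f 0 b = 0.
Proof. by apply: (addrI (f 0 b)); rewrite -bilinDl !addr0. Qed.
Lemma bilin0r a : f a 0 = 0.
Proof. by apply: (addrI (f a 0)); rewrite -bilinDr !addr0. Qed.
Lemma bilinZl k a b : f (k *: a) b = k *: f a b.
Proof. by have := hf.1 b k a 0; rewrite /= bilin0l !addr0. Qed.
Lemma bilinZr k a b : f a (k *: b) = k *: f a b.
Proof. by have := hf.2 a k b 0; rewrite /= bilin0r !addr0. Qed.

End Bilinear.

Definition tadd x y : A ⊗ B := \pi_(A ⊗ B) (repr x ++ repr y).
Definition tscale (k : K) x : A ⊗ B :=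
  \pi_(A ⊗ B) [seq (k *: p.1, p.2) | p <- repr x].
Definition tzero : A ⊗ B := \pi_(A ⊗ B) [::].
Definition topp := tscale (-1).

Section Lift.
Variables (M : lmodType K) (f : A -> B -> M).
Hypothesis hf : is_bilinear f.

Lemma tlift_tadd x y : tlift f (tadd x y) = tlift f x + tlift f y.
Proof. by rewrite tlift_pi // /tsum big_cat. Qed.

Lemma tlift_tscale k x : tlift f (tscale k x) = k *: tlift f x.
Proof.
rewrite tlift_pi // /tlift /tsum big_map scaler_sumr.
by apply: eq_bigr => p _; rewrite /= bilinZl.
Qed.

Lemma tlift_tzero : tlift f tzero = 0.
Proof. by rewrite tlift_pi // /tsum big_nil. Qed.

End Lift.

Let tE := (tlift_tadd, tlift_tscale, tlift_tzero).

Lemma taddA : associative tadd.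
Proof. by move=> x y z; apply: tensorP => M f hf; rewrite !tE // addrA. Qed.
Lemma taddC : commutative tadd.
Proof. by move=> x y; apply: tensorP => M f hf; rewrite !tE // addrC. Qed.
Lemma tadd0 : left_id tzero tadd.
Proof. by move=> x; apply: tensorP => M f hf; rewrite !tE // add0r. Qed.
Lemma taddN : left_inverse tzero topp tadd.
Proof.
by move=> x; apply: tensorP => M f hf; rewrite !tE // scaleN1r addNr.
Qed.
HB.instance Definition _ := GRing.isZmodule.Build (A ⊗ B) taddA taddC tadd0 taddN.

Lemma tscaleA a b x : tscale a (tscale b x) = tscale (a * b) x.
Proof. by apply: tensorP => M f hf; rewrite !tE // scalerA. Qed.
Lemma tscale1 : left_id 1 tscale.
Proof. by move=> x; apply: tensorP => M f hf; rewrite !tE // scale1r. Qed.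
Lemma tscaleDr : right_distributive tscale +%R.
Proof. by move=> k x y; apply: tensorP => M f hf; rewrite !tE // scalerDr. Qed.
Lemma tscaleDl x : {morph tscale^~ x: a b / a + b}.
Proof. by move=> a b; apply: tensorP => M f hf; rewrite !tE // scalerDl. Qed.
HB.instance Definition _ := GRing.Zmodule_isLmodule.Build K (A ⊗ B)
  tscaleA tscale1 tscaleDr tscaleDl.

Lemma tlift_is_linear (M : lmodType K) (f : A -> B -> M) :
  is_bilinear f -> linear (tlift f).
Proof. by move=> hf k x y; rewrite tlift_tadd // tlift_tscale. Qed.

Lemma tens_is_bilinear : is_bilinear tens.
Proof.
split=> [b k a a'|a k b b']; apply: tensorP => M f hf.
  by rewrite tlift_is_linear // !tliftE // bilinDl // bilinZl.
by rewrite tlift_is_linear // !tliftE // bilinDr // bilinZr.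
Qed.
HB.instance Definition _ := bilinear_isBilinear.Build K A B (A ⊗ B) *:%R *:%R
  tens (tens_is_bilinear.1, tens_is_bilinear.2).

Lemma tensor_sum x : x = \sum_(p <- repr x) tens p.1 p.2.
Proof.
apply: tensorP => M f hf.
pose g : {linear A ⊗ B -> M} := HB.pack (tlift f)
  (GRing.isLinear.Build K (A ⊗ B) M *:%R (tlift f) (tlift_is_linear hf)).
rewrite -[tlift f (\sum_(p <- _) _)]/(g _) raddf_sum /=.
by apply: eq_bigr => p _; rewrite /= tliftE.
Qed.

Lemma tensor_ind (P : A ⊗ B -> Prop) :
  P 0 -> (forall a b x, P x -> P (tens a b + x)) -> forall x, P x.
Proof.
move=> P0 PD x; rewrite [x]tensor_sum; elim: (repr x) => [|p s IH].
  by rewrite big_nil.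
by rewrite big_cons; exact: PD.
Qed.

Lemma eq_tensor_linear (M : lmodType K) (g h : {linear A ⊗ B -> M}) :
  (forall a b, g (tens a b) = h (tens a b)) -> g =1 h.
Proof.
move=> gh; elim/tensor_ind => [|a b x IH]; first by rewrite !raddf0.
by rewrite !raddfD /= gh IH.
Qed.

End TensorModule.

Notation "a ⊗t b" := (tens a b) (at level 40, left associativity) : ring_scope.

Definition tmap (K : fieldType) (A B C D : lmodType K) (f : A -> C) (g : B -> D) :
  A ⊗ B -> C ⊗ D := tlift (fun a b => f a ⊗t g b).

Definition tassoc (K : fieldType) (A B C : lmodType K) :
    (A ⊗ B) ⊗ C -> A ⊗ (B ⊗ C) :=
  tlift (fun t c => tlift (fun a b => a ⊗t (b ⊗t c)) t).

Lemma functional_exists (K : fieldType) (V : lmodType K) (e : V) :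
  e != 0 -> exists f : V -> K^o, linear f /\ f e = 1.
Proof.
move=> e0.
pose lin (S : set V) := forall k u v, S u -> S v -> S (k *: u + v).
have [|H [[HL He] Hmax]] :=
    @Zorn_bigcup V [set S : set V | lin S /\ ~ S e].
  move=> F FS Ftot; split=> [k u v [S FS1 Su] [T FT Tv]|[S FS1 Se]]; last first.
    by case: (FS S FS1) => _; apply.
  case: (Ftot S T FS1 FT) => [ST|TS].
    by exists T => //; apply: (FS T FT).1 => //; exact: ST.
  by exists S => //; apply: (FS S FS1).1 => //; exact: TS.
have H0 : H 0.
  apply: contrapT => nH0; have := Hmax [set v | v = 0]; apply.
    split=> [v Hv|/(_ 0 erefl)//]; exfalso; apply: nH0.
    by have := HL (-1) v v Hv Hv; rewrite scaleN1r addNr.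
  split=> [k u v /= -> ->|/= /eqP]; first by rewrite scaler0 addr0.
  by rewrite (negbTE e0).
have Hdec w : exists k, H (w - k *: e).
  apply: contrapT => nw.
  pose B := [set v | exists k h, H h /\ v = k *: w + h].
  apply: (Hmax B).
    split=> [v Hv|BH]; first by exists 0, v; rewrite scale0r add0r.
    apply: nw; exists 0; rewrite scale0r subr0; apply: BH.
    by exists 1, 0; rewrite scale1r addr0.
  split.
    move=> k _ _ [a [h [Hh ->]]] [b [h' [Hh' ->]]].
    exists (k * a + b), (k *: h + h'); split; first exact: HL.
    by rewrite scalerDr scalerDl scalerA addrACA.
  case=> k [h [Hh eE]]; have [k0|k0] := eqVneq k 0.
    by apply: He; rewrite eE k0 scale0r add0r.
  apply: nw; exists k^-1; rewrite eE scalerDr scalerA mulVf // scale1r.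
  have := HL (- k^-1) h 0 Hh H0; rewrite addr0 scaleNr.
  by rewrite opprD addrA subrr add0r.
have Huniq w k k' : H (w - k *: e) -> H (w - k' *: e) -> k = k'.
  move=> Hk Hk'; apply/eqP; rewrite -subr_eq0; apply/negP => /negP kk'.
  apply: He; have := HL (-1) _ _ Hk Hk'.
  rewrite scaleN1r opprB addrA subrK -scalerBl => /(HL (k - k')^-1 _ 0)/(_ H0).
  by rewrite addr0 scalerA mulVf // scale1r.
pose f w : K^o := projT1 (cid (Hdec w)).
have fP w : H (w - f w *: e) by rewrite /f; case: cid.
exists f; split.
  move=> k u v; apply: (Huniq (k *: u + v)); first exact: fP.
  have := HL k _ _ (fP u) (fP v).
  by rewrite scalerBr addrACA -opprD scalerDl scalerA.
by apply: (Huniq e); [exact: fP | rewrite scale1r subrr].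
Qed.

Section TensorAlgebra.
Variables (K : fieldType) (A B : comAlgType K).
Implicit Types x y z : A ⊗ B.

Definition tmul x y : A ⊗ B :=
  tlift (fun a b => tlift (fun a' b' => (a * a') ⊗t (b * b')) y) x.

Let tmulr_bilinear a b :
  is_bilinear (fun (a' : A) (b' : B) => (a * a') ⊗t (b * b')).
Proof.
split=> [b' k u v|a' k u v] /=.
  by rewrite mulrDr -scalerAr (tens_is_bilinear A B).1.
by rewrite mulrDr -scalerAr (tens_is_bilinear A B).2.
Qed.

Let tmull_bilinear y :
  is_bilinear (fun (a : A) (b : B) => tlift (fun a' b' => (a * a') ⊗t (b * b')) y).
Proof.
split=> [b k u v|a k u v]; rewrite /tlift /tsum scaler_sumr -big_split /=;
    apply: eq_bigr => p _.
  by rewrite mulrDl -scalerAl (tens_is_bilinear A B).1.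
by rewrite mulrDl -scalerAl (tens_is_bilinear A B).2.
Qed.

Let tmulDl : left_distributive tmul +%R.
Proof. by move=> x y z; have := tlift_is_linear (tmull_bilinear z) 1 x y; rewrite !scale1r. Qed.

Let tmulZl k x y : k *: tmul x y = tmul (k *: x) y.
Proof.
have h := tlift_is_linear (tmull_bilinear y).
have h0 : tmul 0 y = 0.
  by apply: (addrI (tmul 0 y)); rewrite -tmulDl !addr0.
by have := h k x 0; rewrite -!/(tmul _ _) h0 !addr0.
Qed.

Let tens_mul a b a' b' : tmul (a ⊗t b) (a' ⊗t b') = (a * a') ⊗t (b * b').
Proof. by rewrite /tmul tliftE // tliftE. Qed.

Let tmulC : commutative tmul.
Proof.
move=> x y; rewrite {1}/tmul.
rewrite /tmul /tlift /tsum exchange_big /=; apply: eq_bigr => p _.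
by apply: eq_bigr => q _; rewrite mulrC [q.2 * _]mulrC.
Qed.

Let tmulA : associative tmul.
Proof.
have tmul0 y : tmul 0 y = 0.
  by apply: (addrI (tmul 0 y)); rewrite -tmulDl !addr0.
have tmulDr x y z : tmul x (y + z) = tmul x y + tmul x z.
  by rewrite ![tmul x _]tmulC tmulDl.
have tmulr0 x : tmul x 0 = 0 by rewrite tmulC tmul0.
move=> x y z; elim/tensor_ind: x => [|a b x IHx]; first by rewrite !tmul0.
rewrite !tmulDl -{}IHx; congr (_ + _).
elim/tensor_ind: y => [|a' b' y IHy]; first by rewrite !(tmul0, tmulr0).
rewrite !(tmulDl, tmulDr) {}IHy; congr (_ + _).
elim/tensor_ind: z => [|a'' b'' z IHz]; first by rewrite !tmulr0.
by rewrite !tmulDr {}IHz !tens_mul !mulrA.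
Qed.

Let tmul1 : left_id (1 ⊗t 1) tmul.
Proof.
move=> x; rewrite /tmul tliftE //; rewrite [RHS]tensor_sum.
by apply: eq_bigr => p _; rewrite !mul1r.
Qed.

Let tone_neq0 : (1 ⊗t 1 : A ⊗ B) != 0.
Proof.
have [f [flin f1]] := functional_exists (oner_neq0 A).
have bil : is_bilinear (fun a (b : B) => f a *: b).
  split=> [b k u v|a k u v] /=; last by rewrite scalerDr !scalerA mulrC.
  by rewrite flin scalerDl scalerA.
apply/eqP => /(congr1 (tlift (fun a (b : B) => f a *: b))).
rewrite tliftE // f1 scale1r => /eqP.
have := tlift_is_linear bil (-1) 0 0; rewrite !scaleN1r !addNr => ->.
by rewrite (negbTE (oner_neq0 B)).
Qed.

HB.instance Definition _ := GRing.Zmodule_isComNzRing.Build (A ⊗ B)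
  tmulA tmulC tmul1 tmulDl tone_neq0.
HB.instance Definition _ := GRing.Lmodule_isLalgebra.Build K (A ⊗ B) tmulZl.
HB.instance Definition _ := GRing.Lalgebra_isComAlgebra.Build K (A ⊗ B).

Lemma tensM a b a' b' : (a ⊗t b) * (a' ⊗t b') = (a * a') ⊗t (b * b') :> A ⊗ B.
Proof. exact: tens_mul. Qed.

Lemma tens1 : 1 ⊗t 1 = 1 :> A ⊗ B.
Proof. by []. Qed.

End TensorAlgebra.

Section TensorLift.
Variables (K : fieldType) (A B C : comAlgType K).
Variables (g : {lrmorphism A -> C}) (h : {lrmorphism B -> C}).

(* the algebra morphism A ⊗ B -> C with components g and h *)
Definition tcopair : A ⊗ B -> C := tlift (fun a b => g a * h b).

Lemma tcopair_bilinear : is_bilinear (fun a b => g a * h b).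
Proof.
split=> [b k u v|a k u v] /=.
  by rewrite linearP mulrDl scalerAl.
by rewrite linearP mulrDr scalerAr.
Qed.

Lemma tcopairE a b : tcopair (a ⊗t b) = g a * h b.
Proof. exact: (tliftE _ _ tcopair_bilinear). Qed.

Let tcopair_linear : linear tcopair.
Proof. exact: (tlift_is_linear tcopair_bilinear). Qed.
HB.instance Definition _ := GRing.isLinear.Build K (A ⊗ B) C *:%R tcopair tcopair_linear.

Let tcopair_monoid : monoid_morphism tcopair.
Proof.
split; first by rewrite -tens1 tcopairE !rmorph1 mulr1.
move=> x y; elim/tensor_ind: x => [|a b x IHx]; first by rewrite !(mul0r, raddf0).
rewrite mulrDl !raddfD /= mulrDl {}IHx; congr (_ + _).
elim/tensor_ind: y => [|a' b' y IHy]; first by rewrite !(mulr0, raddf0).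
rewrite mulrDr !raddfD /= mulrDr {}IHy; congr (_ + _).
by rewrite tensM !tcopairE !rmorphM mulrACA.
Qed.
HB.instance Definition _ :=
  GRing.isMonoidMorphism.Build (A ⊗ B) C tcopair tcopair_monoid.

End TensorLift.

Section TensorInj.
Variables (K : fieldType) (A B : comAlgType K).

Definition tinl (a : A) : A ⊗ B := a ⊗t 1.
Definition tinr (b : B) : A ⊗ B := 1 ⊗t b.

Let tinl_linear : linear tinl.
Proof. by move=> k u v; apply: (tens_is_bilinear A B).1. Qed.
HB.instance Definition _ := GRing.isLinear.Build K A (A ⊗ B) *:%R tinl tinl_linear.
Let tinl_monoid : monoid_morphism tinl.
Proof. by split=> // u v; rewrite /tinl tensM mulr1. Qed.
HB.instance Definition _ := GRing.isMonoidMorphism.Build A (A ⊗ B) tinl tinl_monoid.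

Let tinr_linear : linear tinr.
Proof. by move=> k u v; apply: (tens_is_bilinear A B).2. Qed.
HB.instance Definition _ := GRing.isLinear.Build K B (A ⊗ B) *:%R tinr tinr_linear.
Let tinr_monoid : monoid_morphism tinr.
Proof. by split=> // u v; rewrite /tinr tensM mulr1. Qed.
HB.instance Definition _ := GRing.isMonoidMorphism.Build B (A ⊗ B) tinr tinr_monoid.

Lemma tens_inlr a b : a ⊗t b = tinl a * tinr b.
Proof. by rewrite tensM mulr1 mul1r. Qed.

End TensorInj.

(* Commutative Hopf algebras. comul is the comorphism of the multiplication
   G x G -> G of G = Spec A, so that comul f, as a function on G x G, is
   (g, h) |-> f (g h). *)
#[key="A"]
HB.mixin Record ComAlgebra_isHopf (K : fieldType) A of GRing.ComAlgebra K A := {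
  comul : {lrmorphism A -> A ⊗ A};
  counit : {lrmorphism A -> K^o};
  antipode : {linear A -> A};
  comulA : forall a, tassoc (tmap comul id (comul a)) = tmap id comul (comul a);
  comul_counitl : forall a, tlift (fun x y => counit x *: y) (comul a) = a;
  comul_counitr : forall a, tlift (fun x y => counit y *: x) (comul a) = a;
  comul_antipodel :
    forall a, tlift (fun x y => antipode x * y) (comul a) = (counit a)%:A;
  comul_antipoder :
    forall a, tlift (fun x y => x * antipode y) (comul a) = (counit a)%:A
}.

#[short(type="comHopfType")]
HB.structure Definition ComHopf (K : fieldType) :=
  {A of ComAlgebra_isHopf K A & GRing.ComAlgebra K A}.

Section LocalizationDef.
Variables (K : fieldType) (P : comAlgType K) (f : P).

(* (a, m) stands for a / f ^+ m *)
Definition lequiv (x y : P * nat) : bool :=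
  `[< exists k, f ^+ k * (x.1 * f ^+ y.2) = f ^+ k * (y.1 * f ^+ x.2) >].

Lemma lequiv_refl : reflexive lequiv.
Proof. by move=> x; apply/asboolP; exists 0%N. Qed.

Lemma lequiv_sym : symmetric lequiv.
Proof. by move=> x y; apply/asboolP/asboolP => -[k ?]; exists k. Qed.

Lemma lequiv_trans : transitive lequiv.
Proof.
move=> [b n] [a m] [c p] /asboolP[k /= e1] /asboolP[l /= e2].
apply/asboolP; exists (k + l + n)%N => /=; rewrite !exprD.
transitivity (f ^+ k * (a * f ^+ n) * (f ^+ l * f ^+ p)); first by ring.
rewrite e1; transitivity (f ^+ l * (b * f ^+ p) * (f ^+ k * f ^+ m)).
  by ring.
by rewrite e2; ring.
Qed.

Canonical lequiv_equiv := EquivRel lequiv lequiv_refl lequiv_sym lequiv_trans.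

Definition localization (f_nonnil : forall k, f ^+ k != 0) : Type :=
  {eq_quot lequiv}.

Variable f_nonnil : forall k, f ^+ k != 0.
HB.instance Definition _ := Choice.on (localization f_nonnil).
HB.instance Definition _ := EqQuotient.on (localization f_nonnil).

End LocalizationDef.

Section LocalizationTheory.
Variables (K : fieldType) (P : comAlgType K) (f : P).
Variable f_nonnil : forall k, f ^+ k != 0.
Local Notation L := (localization f_nonnil).
Implicit Types x y z : L.

Definition lfrac (a : P) (m : nat) : L := \pi_L (a, m).

Lemma lfracP a m b n :
  lfrac a m = lfrac b n <->
  exists k, f ^+ k * (a * f ^+ n) = f ^+ k * (b * f ^+ m).
Proof.
split=> [/eqmodP/asboolP//|H].
exact/eqmodP/asboolP.
Qed.

Lemma lfrac_ind (Q : L -> Prop) : (forall a m, Q (lfrac a m)) -> forall x, Q x.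
Proof. by move=> QH x; rewrite -[x]reprK; case: (repr x). Qed.

Lemma lfrac_repr a m :
  exists k, f ^+ k * ((repr (lfrac a m)).1 * f ^+ m) =
            f ^+ k * (a * f ^+ (repr (lfrac a m)).2).
Proof. by apply/lfracP; rewrite /lfrac -surjective_pairing reprK. Qed.

Definition ladd x y : L :=
  lfrac ((repr x).1 * f ^+ (repr y).2 + (repr y).1 * f ^+ (repr x).2)
    ((repr x).2 + (repr y).2).
Definition lmul x y : L :=
  lfrac ((repr x).1 * (repr y).1) ((repr x).2 + (repr y).2).
Definition lscale (k : K) x : L := lfrac (k *: (repr x).1) (repr x).2.
Definition lopp x : L := lfrac (- (repr x).1) (repr x).2.

Lemma laddE a m b n :
  ladd (lfrac a m) (lfrac b n) = lfrac (a * f ^+ n + b * f ^+ m) (m + n).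
Proof.
rewrite /ladd; case: (lfrac_repr a m) (lfrac_repr b n).
move: (repr (lfrac a m)) (repr (lfrac b n)) => [a' m'] [b' n'] /= k e1 [l e2].
apply/lfracP; exists (k + l)%N; rewrite !exprD.
transitivity (f ^+ k * (a' * f ^+ m) * (f ^+ l * f ^+ n * f ^+ n')
   + f ^+ l * (b' * f ^+ n) * (f ^+ k * f ^+ m * f ^+ m')); first by ring.
by rewrite e1 e2; ring.
Qed.

Lemma lmulE a m b n : lmul (lfrac a m) (lfrac b n) = lfrac (a * b) (m + n).
Proof.
rewrite /lmul; case: (lfrac_repr a m) (lfrac_repr b n).
move: (repr (lfrac a m)) (repr (lfrac b n)) => [a' m'] [b' n'] /= k e1 [l e2].
apply/lfracP; exists (k + l)%N; rewrite !exprD.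
transitivity (f ^+ k * (a' * f ^+ m) * (f ^+ l * (b' * f ^+ n))); first by ring.
by rewrite e1 e2; ring.
Qed.

Lemma lscaleE k a m : lscale k (lfrac a m) = lfrac (k *: a) m.
Proof.
rewrite /lscale; case: (lfrac_repr a m); move: (repr _) => [a' m'] /= l e.
by apply/lfracP; exists l; rewrite -!scalerAl -!scalerAr e.
Qed.

Lemma loppE a m : lopp (lfrac a m) = lfrac (- a) m.
Proof.
rewrite /lopp; case: (lfrac_repr a m); move: (repr _) => [a' m'] /= l e.
by apply/lfracP; exists l; rewrite !mulNr !mulrN e.
Qed.

Let lE := (laddE, lmulE, lscaleE, loppE).

Let laddA : associative ladd.
Proof.
elim/lfrac_ind => a m; elim/lfrac_ind => b n; elim/lfrac_ind => c p.
by rewrite !lE; apply/lfracP; exists 0%N; rewrite !exprD; ring.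
Qed.
Let laddC : commutative ladd.
Proof.
elim/lfrac_ind => a m; elim/lfrac_ind => b n.
by rewrite !lE; apply/lfracP; exists 0%N; rewrite !exprD; ring.
Qed.
Let ladd0 : left_id (lfrac 0 0) ladd.
Proof.
elim/lfrac_ind => a m.
by rewrite !lE; apply/lfracP; exists 0%N; rewrite ?exprD; ring.
Qed.
Let laddN : left_inverse (lfrac 0 0) lopp ladd.
Proof.
elim/lfrac_ind => a m.
by rewrite !lE; apply/lfracP; exists 0%N; rewrite ?exprD; ring.
Qed.
HB.instance Definition _ := GRing.isZmodule.Build L laddA laddC ladd0 laddN.

Let lmulA : associative lmul.
Proof.
elim/lfrac_ind => a m; elim/lfrac_ind => b n; elim/lfrac_ind => c p.
by rewrite !lE; apply/lfracP; exists 0%N; rewrite !exprD; ring.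
Qed.
Let lmulC : commutative lmul.
Proof.
elim/lfrac_ind => a m; elim/lfrac_ind => b n.
by rewrite !lE; apply/lfracP; exists 0%N; rewrite !exprD; ring.
Qed.
Let lmul1 : left_id (lfrac 1 0) lmul.
Proof.
elim/lfrac_ind => a m.
by rewrite !lE; apply/lfracP; exists 0%N; rewrite ?exprD; ring.
Qed.
Let lmulDl : left_distributive lmul ladd.
Proof.
elim/lfrac_ind => a m; elim/lfrac_ind => b n; elim/lfrac_ind => c p.
by rewrite !lE; apply/lfracP; exists 0%N; rewrite !exprD; ring.
Qed.
Let lone_neq0 : lfrac 1 0 != lfrac 0 0.
Proof.
apply/eqP => /lfracP[k]; rewrite !mul0r mulr0 !mul1r mulr1 => /eqP.
by rewrite (negbTE (f_nonnil k)).
Qed.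
HB.instance Definition _ := GRing.Zmodule_isComNzRing.Build L
  lmulA lmulC lmul1 lmulDl lone_neq0.

Let lscaleA a b x : lscale a (lscale b x) = lscale (a * b) x.
Proof. by elim/lfrac_ind: x => c p; rewrite !lE scalerA. Qed.
Let lscale1 : left_id 1 lscale.
Proof. by elim/lfrac_ind => c p; rewrite !lE scale1r. Qed.
Let lscaleDr : right_distributive lscale +%R.
Proof.
move=> k; elim/lfrac_ind => a m; elim/lfrac_ind => b n.
by rewrite -[_ + _]/(ladd _ _) -[_ + _]/(ladd _ _) !lE scalerDr !scalerAl.
Qed.
Let lscaleDl x : {morph lscale^~ x : a b / a + b}.
Proof.
move=> a b; elim/lfrac_ind: x => c p.
rewrite -[lscale a _ + _]/(ladd _ _) !lE scalerDl; apply/lfracP; exists 0%N.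
by rewrite exprD !mulrDl; ring.
Qed.
HB.instance Definition _ := GRing.Zmodule_isLmodule.Build K L
  lscaleA lscale1 lscaleDr lscaleDl.

Let lscaleAl k x y : k *: (x * y) = k *: x * y.
Proof.
elim/lfrac_ind: x => a m; elim/lfrac_ind: y => b n.
by rewrite -[LHS]/(lscale _ (lmul _ _)) -[RHS]/(lmul (lscale _ _) _) !lE scalerAl.
Qed.
HB.instance Definition _ := GRing.Lmodule_isLalgebra.Build K L lscaleAl.
HB.instance Definition _ := GRing.Lalgebra_isComAlgebra.Build K L.

Lemma lfracM a m b n : lfrac a m * lfrac b n = lfrac (a * b) (m + n).
Proof. exact: lmulE. Qed.

Lemma lfracD a m b n :
  lfrac a m + lfrac b n = lfrac (a * f ^+ n + b * f ^+ m) (m + n).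
Proof. exact: laddE. Qed.

Lemma lfracZ k a m : k *: lfrac a m = lfrac (k *: a) m.
Proof. exact: lscaleE. Qed.

Definition linj (a : P) : L := lfrac a 0.

Let linj_linear : linear linj.
Proof. by move=> k u v; rewrite lfracZ lfracD !mulr1. Qed.
HB.instance Definition _ := GRing.isLinear.Build K P L *:%R linj linj_linear.
Let linj_monoid : monoid_morphism linj.
Proof. by split=> // u v; rewrite lfracM. Qed.
HB.instance Definition _ := GRing.isMonoidMorphism.Build P L linj linj_monoid.

Lemma linj_inv m : linj (f ^+ m) * lfrac 1 m = 1.
Proof.
by rewrite lfracM mulr1; apply/lfracP; exists 0%N; rewrite !expr0 add0n !mulr1 !mul1r.
Qed.

Lemma lfracE a m : lfrac a m = linj a * lfrac 1 1 ^+ m.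
Proof.
have -> : lfrac 1 1 ^+ m = lfrac 1 m.
  elim: m => [|m IH]; first by rewrite expr0.
  by rewrite exprS IH lfracM mulr1.
by rewrite lfracM mulr1.
Qed.

Section Lift.
Variables (B : comAlgType K) (g : {lrmorphism P -> B}) (u : B).

Definition loc_lift (gfu : g f * u = 1) (x : L) : B :=
  g (repr x).1 * u ^+ (repr x).2.

Variable gfu : g f * u = 1.

Lemma loc_liftE a m : loc_lift gfu (lfrac a m) = g a * u ^+ m.
Proof.
rewrite /loc_lift; case: (lfrac_repr a m); move: (repr _) => [a' m'] /= k.
move=> /(congr1 g); rewrite !rmorphM !rmorphXn /= => e.
have gu p : g f ^+ p * u ^+ p = 1 by rewrite -exprMn gfu expr1n.
transitivity (g f ^+ k * (g a' * g f ^+ m) * (u ^+ k * u ^+ m * u ^+ m')).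
  transitivity (g a' * u ^+ m' * (g f ^+ k * u ^+ k) * (g f ^+ m * u ^+ m)).
    by rewrite !gu !mulr1.
  by ring.
rewrite e.
transitivity (g a * u ^+ m * (g f ^+ k * u ^+ k) * (g f ^+ m' * u ^+ m')).
  by ring.
by rewrite !gu !mulr1.
Qed.

Let loc_lift_linear : linear (loc_lift gfu).
Proof.
have gu p : g f ^+ p * u ^+ p = 1 by rewrite -exprMn gfu expr1n.
move=> k; elim/lfrac_ind => a m; elim/lfrac_ind => b n.
rewrite lfracZ lfracD !loc_liftE rmorphD !rmorphM !rmorphXn /= linearZ /=.
rewrite -!scalerAl exprD mulrDl -!scalerAl; congr (_ *: _ + _).
  by transitivity (g a * u ^+ m * (g f ^+ n * u ^+ n)); [ring|rewrite gu mulr1].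
by transitivity (g b * u ^+ n * (g f ^+ m * u ^+ m)); [ring|rewrite gu mulr1].
Qed.
HB.instance Definition _ :=
  GRing.isLinear.Build K L B *:%R (loc_lift gfu) loc_lift_linear.

Let loc_lift_monoid : monoid_morphism (loc_lift gfu).
Proof.
split; first by rewrite loc_liftE rmorph1 mulr1.
elim/lfrac_ind => a m; elim/lfrac_ind => b n.
by rewrite lfracM !loc_liftE rmorphM exprD mulrACA.
Qed.
HB.instance Definition _ :=
  GRing.isMonoidMorphism.Build L B (loc_lift gfu) loc_lift_monoid.

Lemma loc_lift_inj a : loc_lift gfu (linj a) = g a.
Proof. by rewrite loc_liftE mulr1. Qed.

End Lift.

Lemma loc_ext (B : comAlgType K) (g h : {lrmorphism L -> B}) :
  (forall a, g (linj a) = h (linj a)) -> g =1 h.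
Proof.
move=> gh; elim/lfrac_ind => a m; rewrite lfracE !rmorphM !rmorphXn /= gh.
suff -> : g (lfrac 1 1) = h (lfrac 1 1) by [].
have e : linj f * lfrac 1 1 = 1 by have := linj_inv 1.
have eg := congr1 g e; have eh := congr1 h e.
move: eg eh; rewrite !rmorphM !rmorph1 /= gh => eg eh.
by rewrite -[LHS]mul1r -eh mulrAC eg mul1r.
Qed.

End LocalizationTheory.

Section PolyLift.
Variables (K : fieldType) (m : nat) (B : comAlgType K) (h : 'I_m -> B).

Definition poly_lift (p : mpoly m K) : B := mmap (in_alg B) h p.

Let poly_lift_linear : linear poly_lift.
Proof.
by move=> k p q; rewrite /poly_lift raddfD /= mmapZ /= mulr_algl.
Qed.
HB.instance Definition _ :=
  GRing.isLinear.Build K (mpoly m K) B *:%R poly_lift poly_lift_linear.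

Let poly_lift_monoid : monoid_morphism poly_lift.
Proof. by split=> [|p q]; rewrite /poly_lift ?rmorph1 ?rmorphM. Qed.
HB.instance Definition _ :=
  GRing.isMonoidMorphism.Build (mpoly m K) B poly_lift poly_lift_monoid.

Lemma poly_liftX i : poly_lift (mpolyX K (mnm1 i)) = h i.
Proof. by rewrite /poly_lift mmapX mmap1U. Qed.

End PolyLift.

Lemma poly_ext (K : fieldType) (m : nat) (B : comAlgType K)
    (g h : {lrmorphism mpoly m K -> B}) :
  (forall i, g (mpolyX K (mnm1 i)) = h (mpolyX K (mnm1 i))) -> g =1 h.
Proof.
move=> gh p; rewrite (mpolyE p) !raddf_sum; apply: eq_bigr => a _ /=.
rewrite !linearZ /=; congr (_ *: _); rewrite mpolyXE_id !rmorph_prod.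
by apply: eq_bigr => i _; rewrite !rmorphXn /= gh.
Qed.

Section GLCoordDef.
Variables (K : fieldType) (n : nat).

Definition genmx : 'M[mpoly (n * n) K]_n :=
  \matrix_(i, j) mpolyX K (mnm1 (mxvec_index i j)).

Lemma poly_lift_genmx (B : comAlgType K) (M : 'M[B]_n) i j :
  poly_lift (mxvec M 0) (genmx i j) = M i j.
Proof. by rewrite mxE poly_liftX mxvecE. Qed.

Lemma poly_lift_det (B : comAlgType K) (M : 'M[B]_n) :
  poly_lift (mxvec M 0) (\det genmx) = \det M.
Proof.
rewrite -det_map_mx; congr (\det _); apply/matrixP => i j.
by rewrite mxE; exact: poly_lift_genmx.
Qed.

Lemma det_genmx_nonnil k : (\det genmx) ^+ k != 0.
Proof.
apply/eqP => /(congr1 (poly_lift (mxvec (1%:M : 'M[K^o]_n) 0))).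
rewrite rmorphXn /= poly_lift_det det1 expr1n rmorph0 => /eqP.
by rewrite oner_eq0.
Qed.

(* K[x_ij]_det *)
Definition gl_coord : Type := localization det_genmx_nonnil.
HB.instance Definition _ := GRing.ComAlgebra.on gl_coord.

Definition glx : 'M[gl_coord]_n := map_mx (linj det_genmx_nonnil) genmx.
Definition gl_invdet : gl_coord := lfrac det_genmx_nonnil 1 1.

Lemma det_glx : \det glx * gl_invdet = 1.
Proof. by rewrite det_map_mx; exact: (linj_inv det_genmx_nonnil 1). Qed.

Section Lift.
Variables (B : comAlgType K) (M : 'M[B]_n) (u : B).
Hypothesis Mu : \det M * u = 1.

Let gl_lift_subproof : poly_lift (mxvec M 0) (\det genmx) * u = 1.
Proof. by rewrite poly_lift_det. Qed.

Definition gl_lift : {lrmorphism gl_coord -> B} := loc_lift gl_lift_subproof.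

Lemma gl_liftE i j : gl_lift (glx i j) = M i j.
Proof. by rewrite mxE [LHS]loc_lift_inj; exact: poly_lift_genmx. Qed.

End Lift.

Lemma gl_ext (B : comAlgType K) (g h : {lrmorphism gl_coord -> B}) :
  (forall i j, g (glx i j) = h (glx i j)) -> g =1 h.
Proof.
move=> gh; apply: loc_ext => p.
apply: (@poly_ext _ _ _ (g \o linj det_genmx_nonnil) (h \o linj det_genmx_nonnil)).
move=> k /=; case/mxvec_indexP: k => i j.
by have := gh i j; rewrite !mxE.
Qed.

End GLCoordDef.

Lemma tmap_tcopair (K : fieldType) (A B C D : comAlgType K)
    (f : {lrmorphism A -> C}) (g : {lrmorphism B -> D}) :
  tmap f g =1 tcopair (@tinl K C D \o f) (@tinr K C D \o g).
Proof. by move=> x; apply: eq_bigr => p _; rewrite tens_inlr. Qed.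

Lemma tassoc_tcopair (K : fieldType) (A B C : comAlgType K) :
  @tassoc K A B C =1
  tcopair (tcopair (@tinl K A (B ⊗ C)) (@tinr K A (B ⊗ C) \o @tinl K B C))
    (@tinr K A (B ⊗ C) \o @tinr K B C).
Proof.
move=> x; apply: eq_bigr => -[t c] _ /=; rewrite /tcopair /tlift /tsum mulr_suml.
apply: eq_bigr => -[a b] _ /=.
by rewrite -mulrA -rmorphM -tens_inlr -tens_inlr.
Qed.

Lemma tens_suml (K : fieldType) (A B : lmodType K) (I : Type) (r : seq I)
    (F : I -> A) (b : B) :
  (\sum_(i <- r) F i) ⊗t b = \sum_(i <- r) F i ⊗t b.
Proof.
have hb := tens_is_bilinear A B.
by apply: (big_morph (fun a => a ⊗t b)) => [x y|]; rewrite ?bilinDl ?bilin0l.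
Qed.

Lemma tens_sumr (K : fieldType) (A B : lmodType K) (I : Type) (r : seq I)
    (F : I -> B) (a : A) :
  a ⊗t (\sum_(i <- r) F i) = \sum_(i <- r) a ⊗t F i.
Proof.
have hb := tens_is_bilinear A B.
by apply: (big_morph (fun b => a ⊗t b)) => [x y|]; rewrite ?bilinDr ?bilin0r.
Qed.

Section TensorPure.
Variables (K : fieldType) (A B C D : comAlgType K).

Lemma tmapE (f : {lrmorphism A -> C}) (g : {lrmorphism B -> D}) a b :
  tmap f g (a ⊗t b) = f a ⊗t g b.
Proof. by rewrite tmap_tcopair tcopairE -tens_inlr. Qed.

Lemma tmap_sum (f : {lrmorphism A -> C}) (g : {lrmorphism B -> D})
    (I : Type) (r : seq I) (F : I -> A ⊗ B) :
  tmap f g (\sum_(i <- r) F i) = \sum_(i <- r) tmap f g (F i).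
Proof.
rewrite tmap_tcopair raddf_sum; apply: eq_bigr => i _.
exact: (esym (tmap_tcopair f g (F i))).
Qed.

Lemma tassocE (a : A) (b : B) (c : C) :
  tassoc ((a ⊗t b) ⊗t c) = a ⊗t (b ⊗t c).
Proof.
by rewrite tassoc_tcopair tcopairE /= tcopairE /= -mulrA -rmorphM -!tens_inlr.
Qed.

End TensorPure.

Definition unit_alg (K : fieldType) (B : comAlgType K) : K^o -> B := in_alg B.

Section UnitAlg.
Variables (K : fieldType) (B : comAlgType K).
Let unit_alg_linear : linear (@unit_alg K B).
Proof. by move=> k u v; rewrite /unit_alg /= scalerDl scalerA. Qed.
HB.instance Definition _ :=
  GRing.isLinear.Build K K^o B *:%R (@unit_alg K B) unit_alg_linear.
HB.instance Definition _ := GRing.RMorphism.copy (@unit_alg K B) (in_alg B).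
End UnitAlg.

Section GLHopf.
Variables (K : fieldType) (n : nat) (O : comAlgType K) (X : 'M[O]_n) (d : O).
Hypothesis Xd : \det X * d = 1.
Variable lift : forall (B : comAlgType K) (M : 'M[B]_n) (u : B),
  \det M * u = 1 -> {lrmorphism O -> B}.
Hypothesis liftE : forall B M u (Mu : \det M * u = 1) i j,
  @lift B M u Mu (X i j) = M i j.
Hypothesis ext : forall (B : comAlgType K) (g h : {lrmorphism O -> B}),
  (forall i j, g (X i j) = h (X i j)) -> g =1 h.

Let comul_mx : 'M[O ⊗ O]_n := map_mx (@tinl K O O) X *m map_mx (@tinr K O O) X.

Let comul_det : \det comul_mx * (d ⊗t d) = 1.
Proof.
have el : tinl O (\det X) * tinl O (d) = 1.
  by rewrite -rmorphM /= Xd rmorph1.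
have er : tinr O (\det X) * tinr O (d) = 1.
  by rewrite -rmorphM /= Xd rmorph1.
rewrite det_mulmx (det_map_mx (@tinl K O O)) (det_map_mx (@tinr K O O)).
by rewrite tens_inlr mulrACA /= el er mulr1.
Qed.

Definition gl_comul : {lrmorphism O -> O ⊗ O} := lift comul_det.

Lemma gl_comulE i j : gl_comul (X i j) = \sum_k X i k ⊗t X k j.
Proof.
rewrite liftE mxE; apply: eq_bigr => k _.
by rewrite [map_mx _ _ _ _]mxE [in X in _ * X]mxE -tens_inlr.
Qed.

Let counit_det : \det (1%:M : 'M[K^o]_n) * 1 = 1.
Proof. by rewrite det1 mulr1. Qed.

Definition gl_counit : {lrmorphism O -> K^o} := lift counit_det.

Lemma gl_counitE i j : gl_counit (X i j) = (i == j)%:R.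
Proof. by rewrite liftE mxE. Qed.

Definition gl_inv : 'M[O]_n := d *: \adj X.

Lemma gl_mulV : X *m gl_inv = 1%:M.
Proof.
rewrite -scalemxAr mul_mx_adj scale_scalar_mx mulrC.
by rewrite Xd.
Qed.

Lemma gl_mulVl : gl_inv *m X = 1%:M.
Proof.
rewrite -scalemxAl mul_adj_mx scale_scalar_mx mulrC.
by rewrite Xd.
Qed.

Let antipode_det : \det gl_inv * \det X = 1.
Proof. by rewrite -det_mulmx gl_mulVl det1. Qed.

Definition gl_antipode : {lrmorphism O -> O} := lift antipode_det.

Lemma gl_antipodeE i j : gl_antipode (X i j) = gl_inv i j.
Proof. exact: liftE. Qed.

Lemma gl_comulA a :
  tassoc (tmap gl_comul id (gl_comul a)) = tmap id gl_comul (gl_comul a).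
Proof.
pose tl : {lrmorphism O ⊗ O -> (O ⊗ O) ⊗ O} :=
  tcopair (@tinl K (O ⊗ O) O \o gl_comul) (@tinr K (O ⊗ O) O \o @idfun O).
pose tr : {lrmorphism O ⊗ O -> O ⊗ (O ⊗ O)} :=
  tcopair (@tinl K O (O ⊗ O) \o @idfun O) (@tinr K O (O ⊗ O) \o gl_comul).
pose ta : {lrmorphism (O ⊗ O) ⊗ O -> O ⊗ (O ⊗ O)} :=
  tcopair (tcopair (@tinl K O (O ⊗ O))
    (@tinr K O (O ⊗ O) \o @tinl K O O)) (@tinr K O (O ⊗ O) \o @tinr K O O).
have tlE x : tmap gl_comul id x = tl x.
  exact: (tmap_tcopair gl_comul (@idfun O)).
have trE x : tmap id gl_comul x = tr x.
  exact: (tmap_tcopair (@idfun O) gl_comul).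
have taE x : tassoc x = ta x by exact: tassoc_tcopair.
have tlE2 x y : tl (x ⊗t y) = gl_comul x ⊗t y.
  by rewrite -tlE (tmapE gl_comul (@idfun O)).
have trE2 x y : tr (x ⊗t y) = x ⊗t gl_comul y.
  by rewrite -trE (tmapE (@idfun O) gl_comul).
have taE2 x y z : ta ((x ⊗t y) ⊗t z) = x ⊗t (y ⊗t z).
  by rewrite -taE tassocE.
rewrite tlE taE trE.
move: tl tr ta {tlE trE taE} tlE2 trE2 taE2 => tl tr ta tlE trE taE.
apply: (@ext _ (ta \o (tl \o gl_comul)) (tr \o gl_comul)) => i j.
rewrite /= gl_comulE (raddf_sum tl) (raddf_sum ta) (raddf_sum tr).
have tlX k : ta (tl (X i k ⊗t X k j)) =
    \sum_l X i l ⊗t (X l k ⊗t X k j).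
  rewrite tlE gl_comulE tens_suml raddf_sum.
  by apply: eq_bigr => l _; exact: taE.
have trX k : tr (X i k ⊗t X k j) = \sum_l X i k ⊗t (X k l ⊗t X l j).
  by rewrite trE gl_comulE tens_sumr.
rewrite (eq_bigr _ (fun k _ => tlX k)) exchange_big /=.
by apply: eq_bigr => k _; rewrite trX.
Qed.

Lemma gl_counitl a : tlift (fun x y => gl_counit x *: y) (gl_comul a) = a.
Proof.
transitivity (tcopair (@unit_alg K O \o gl_counit) (@idfun O) (gl_comul a)).
  by apply: eq_bigr => p _; rewrite /= mulr_algl.
apply: (@ext _ (tcopair (@unit_alg K O \o gl_counit) (@idfun O) \o gl_comul)
  (@idfun O)) => i j /=.
rewrite gl_comulE raddf_sum (bigD1 i) //= big1 => [|k ki].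
  by rewrite tcopairE /= gl_counitE eqxx /unit_alg /= scale1r mul1r addr0.
by rewrite tcopairE /= gl_counitE eq_sym (negbTE ki) /unit_alg /= scale0r mul0r.
Qed.

Lemma gl_counitr a : tlift (fun x y => gl_counit y *: x) (gl_comul a) = a.
Proof.
transitivity (tcopair (@idfun O) (@unit_alg K O \o gl_counit) (gl_comul a)).
  by apply: eq_bigr => p _; rewrite /= mulr_algr.
apply: (@ext _ (tcopair (@idfun O) (@unit_alg K O \o gl_counit) \o gl_comul)
  (@idfun O)) => i j /=.
rewrite gl_comulE raddf_sum (bigD1 j) //= big1 => [|k kj].
  by rewrite tcopairE /= gl_counitE eqxx /unit_alg /= scale1r mulr1 addr0.
by rewrite tcopairE /= gl_counitE (negbTE kj) /unit_alg /= scale0r mulr0.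
Qed.

Lemma gl_antipodel a :
  tlift (fun x y => gl_antipode x * y) (gl_comul a) = (gl_counit a)%:A.
Proof.
transitivity (tcopair gl_antipode (@idfun O) (gl_comul a)) => //.
apply: (@ext _ (tcopair gl_antipode (@idfun O) \o gl_comul)
  (@unit_alg K O \o gl_counit)) => i j /=.
rewrite gl_comulE raddf_sum /= gl_counitE.
transitivity ((gl_inv *m X) i j).
  by rewrite [RHS]mxE; apply: eq_bigr => k _; rewrite tcopairE gl_antipodeE.
by rewrite gl_mulVl [LHS]mxE /unit_alg /= scaler_nat.
Qed.

Lemma gl_antipoder a :
  tlift (fun x y => x * gl_antipode y) (gl_comul a) = (gl_counit a)%:A.
Proof.
transitivity (tcopair (@idfun O) gl_antipode (gl_comul a)) => //.
apply: (@ext _ (tcopair (@idfun O) gl_antipode \o gl_comul)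
  (@unit_alg K O \o gl_counit)) => i j /=.
rewrite gl_comulE raddf_sum /= gl_counitE.
transitivity ((X *m gl_inv) i j).
  by rewrite [RHS]mxE; apply: eq_bigr => k _; rewrite tcopairE gl_antipodeE.
by rewrite gl_mulV [LHS]mxE /unit_alg /= scaler_nat.
Qed.

End GLHopf.

Section GLHopfInstance.
Variables (K : fieldType) (n : nat).
Let Xd := @det_glx K n.
Let liftE := @gl_liftE K n.
Let ext := @gl_ext K n.
HB.instance Definition _ := ComAlgebra_isHopf.Build K (gl_coord K n)
  (gl_comulA Xd liftE ext) (gl_counitl Xd liftE ext) (gl_counitr Xd liftE ext)
  (gl_antipodel Xd liftE ext) (gl_antipoder Xd liftE ext).
End GLHopfInstance.

Lemma comul_glx (K : fieldType) n i j :
  comul (glx K n i j) = \sum_k glx K n i k ⊗t glx K n k j.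
Proof. exact: (gl_comulE (@det_glx K n) (@gl_liftE K n)). Qed.

Lemma counit_glx (K : fieldType) n i j :
  counit (glx K n i j) = (i == j)%:R.
Proof. exact: (gl_counitE (@gl_liftE K n)). Qed.

Definition is_hopf_morphism (K : fieldType) (A B : comHopfType K)
    (f : {lrmorphism A -> B}) : Prop :=
  (forall a, comul (f a) = tmap f f (comul a)) /\
  (forall a, counit (f a) = counit a).

Definition finitely_generated (K : fieldType) (A : comAlgType K) : Prop :=
  exists s : seq A, forall S : {pred A},
    subalg_closed S -> {subset s <= S} -> forall a, a \in S.

(* The points of Spec A are the prime ideals; the Zariski open sets are the
   complements of the sets V(S) of the primes containing S. *)
Definition Spec (A : comNzRingType) : Type :=
  {I : A -> bool | idealr_closed I /\ prime_idealr_closed I}.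

Definition prime_of (A : comNzRingType) (p : Spec A) : A -> bool := sval p.

Section Zariski.
Variable A : comNzRingType.
Implicit Types (p : Spec A) (S : set A).

HB.instance Definition _ := gen_eqMixin (Spec A).
HB.instance Definition _ := gen_choiceMixin (Spec A).

Definition zariski_closed_set S : set (Spec A) :=
  [set p | forall a, S a -> a \in prime_of p].

Definition zariski_open (U : set (Spec A)) : Prop :=
  exists S, U = ~` zariski_closed_set S.

Let prime_1 p : (1 \in prime_of p) = false.
Proof. by case: (svalP p) => -[_ p1 _] _; apply/negbTE. Qed.

Let prime_mulr p a u :
  u \in prime_of p -> a * u \in prime_of p.
Proof. by case: (svalP p) => /idealr_closed_nontrivial[_ H] _; exact: H. Qed.

Let zariski_openT : zariski_open setT.
Proof.
exists setT; apply/seteqP; split=> // p _ /(_ 1 I).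
by rewrite prime_1.
Qed.

Let zariski_openI : setI_closed zariski_open.
Proof.
move=> _ _ [S ->] [T ->]; exists [set a | exists s t, [/\ S s, T t & a = s * t]].
rewrite -setCU; congr (~` _); apply/seteqP; split=> p.
  move=> [pS|pT] _ [s [t [Ss Tt ->]]]; first by rewrite mulrC prime_mulr ?pS.
  by rewrite prime_mulr ?pT.
move=> pST; apply: contrapT => /not_orP[nS nT].
have [s [Ss sp]] : exists s, S s /\ s \notin prime_of p.
  apply: contrapT => H; apply: nS => s Ss; apply/negPn/negP => sp.
  by apply: H; exists s.
apply: nT => t Tt; have /(svalP p).2/orP[|//] : s * t \in prime_of p by apply: pST; exists s, t.
by rewrite (negbTE sp).
Qed.

Let zariski_open_bigU (I : Type) (f : I -> set (Spec A)) :
  (forall i, zariski_open (f i)) -> zariski_open (\bigcup_i f i).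
Proof.
move=> /choice[S fS]; exists (\bigcup_i S i).
rewrite (_ : f = fun i => ~` zariski_closed_set (S i)); last exact/funext.
rewrite -setC_bigcap; congr (~` _); apply/seteqP; split=> p.
  by move=> H a [i _ Sa]; exact: (H i).
by move=> H i _ a Sa; apply: H; exists i.
Qed.

HB.instance Definition _ := isOpenTopological.Build (Spec A)
  zariski_openT zariski_openI zariski_open_bigU.

Lemma Spec_openE : open = zariski_open.
Proof. by []. Qed.

End Zariski.

Section RationalPoints.
Variables (K : fieldType) (A : comAlgType K).

(* a rational point Spec K -> Spec A *)
Definition rational_point : Type := {lrmorphism A -> K^o}.

Section Kernel.
Variable x : rational_point.

Lemma ker_prime_ideal :
  let I := [pred a | x a == 0] in idealr_closed I /\ prime_idealr_closed I.
Proof.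
split=> [|u v]; last by rewrite !inE rmorphM mulf_eq0.
split; rewrite ?inE ?rmorph0 ?rmorph1 ?oner_eq0 // => a u v.
rewrite !inE => /eqP xu /eqP xv.
by rewrite rmorphD rmorphM /= xu xv mulr0 addr0.
Qed.

Definition rational_point_Spec : Spec A := exist _ _ ker_prime_ideal.

End Kernel.

Definition without_imaginary_components : Prop :=
  forall p : Spec A, exists x : rational_point,
    connected_component [set: Spec A] p (rational_point_Spec x).

End RationalPoints.

Arguments without_imaginary_components {K} A.

(* A linear representation of Spec A on E. A basis of E identifies Gl(E) with
   Spec K[x_ij]_det. *)
Record representation (K : fieldType) (A : comHopfType K) (E : vectType K) :=
  Representation {
    rep_basis : (\dim {:E}).-tuple E;
    rep_basisP : basis_of fullv rep_basis;
    rep_comorphism : {lrmorphism gl_coord K (\dim {:E}) -> A};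
    rep_hopf : is_hopf_morphism rep_comorphism
  }.

Section Invariants.
Variables (K : fieldType) (A : comHopfType K) (E : vectType K).
Variable rho : representation A E.
Local Notation n := (\dim {:E}).
Local Notation e := (rep_basis rho).

Definition rep_mx : 'M[A]_n := map_mx (rep_comorphism rho) (glx K n).

(* E is seen as the affine space Spec K[y_1, ..., y_n], whose coordinates are
   taken in the basis e. orbit_comorphism v is the comorphism K[y] -> A of
   g |-> rho(g)(v), and const_comorphism v that of the constant map v. *)
Definition orbit_comorphism (v : E) : mpoly n K -> A :=
  poly_lift (fun i => \sum_j rep_mx i j * (coord e j v)%:A).

Definition const_comorphism (v : E) : mpoly n K -> A :=
  poly_lift (fun i => (coord e i v)%:A).

Definition invariants : set E :=
  [set v | orbit_comorphism v =1 const_comorphism v].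

(* the automorphism rho(g) of E, for g in G(K) *)
Definition rep_at (g : rational_point A) (v : E) : E :=
  \sum_i (\sum_j (g (rep_mx i j) : K) * coord e j v) *: e`_i.

Definition rational_invariants : set E :=
  [set v | forall g : rational_point A, rep_at g v = v].

Lemma invariantsP v :
  invariants v <->
  forall i, \sum_j rep_mx i j * (coord e j v)%:A = (coord e i v)%:A.
Proof.
split=> [H i|H].
  by have := H (mpolyX K (mnm1 i)); rewrite [LHS]poly_liftX [RHS]poly_liftX.
apply: (@poly_ext _ _ _ (poly_lift (fun i => \sum_j rep_mx i j * (coord e j v)%:A))
  (poly_lift (fun i => (coord e i v)%:A))) => i.
by rewrite [LHS]poly_liftX [RHS]poly_liftX.
Qed.

Lemma invariants_sub : invariants `<=` rational_invariants.
Proof.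
move=> v /invariantsP H g; rewrite /rep_at.
rewrite [RHS](coord_basis (rep_basisP rho) (memvf v)).
apply: eq_bigr => i _; congr (_ *: _).
have gA c : g c%:A = c by rewrite linearZ /= rmorph1; exact: mulr1.
rewrite -[RHS]gA -H raddf_sum; apply: eq_bigr => j _.
by rewrite [in RHS]/= (rmorphM g) /= gA.
Qed.

Lemma rep_at_linear g : linear (rep_at g).
Proof.
move=> k u v; rewrite /rep_at scaler_sumr -big_split /=; apply: eq_bigr => i _.
rewrite scalerA -scalerDl; congr (_ *: _); rewrite mulr_sumr -big_split /=.
by apply: eq_bigr => j _; rewrite linearP /= mulrDr mulrCA.
Qed.

Lemma invariants_submod : submod_closed [in invariants].
Proof.
split=> [|k u v].
  rewrite inE; apply/invariantsP => i; rewrite linear0 scale0r big1 // => j _.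
  by rewrite linear0 scale0r mulr0.
rewrite !inE => /invariantsP Hu /invariantsP Hv; apply/invariantsP => i.
rewrite linearP scalerDl -scalerA -Hu -Hv scaler_sumr -big_split /=.
by apply: eq_bigr => j _; rewrite linearP /= scalerDl mulrDr -scalerA -scalerAr.
Qed.

Lemma rational_invariants_submod : submod_closed [in rational_invariants].
Proof.
split=> [|k u v]; rewrite !inE.
  move=> g; rewrite /rep_at big1 // => i _; rewrite big1 ?scale0r // => j _.
  by rewrite linear0 mulr0.
by move=> Hu Hv g; rewrite rep_at_linear Hu Hv.
Qed.

Lemma comul_rep_mx i j :
  comul (rep_mx i j) = \sum_k rep_mx i k ⊗t rep_mx k j.
Proof.
rewrite [rep_mx i j]mxE (rep_hopf rho).1 comul_glx.
rewrite tmap_sum; apply: eq_bigr => k _.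
by rewrite tmapE ![rep_mx _ _]mxE.
Qed.

Lemma counit_rep_mx i j : counit (rep_mx i j) = (i == j)%:R.
Proof. by rewrite [rep_mx i j]mxE (rep_hopf rho).2 counit_glx. Qed.

End Invariants.

(* Main.v *)
(* Write m for the augmentation ideal of A. For a point derivation delta at the
   identity, the left-invariant derivation D = (id ⊗ delta) \o comul is locally
   finite, so a |-> \sum_n counit (D^n a) / n! converges and is a rational point
   exp(delta). Differentiating along t |-> exp(t delta), a G(R)-invariant vector v
   is killed by the Lie algebra: the functions w_i, the coordinates of
   rho(g)(v) - v, satisfy D w_i = 0 for all these D. In characteristic 0 the
   derivation \sum_i y_i D_i, with y_i dual to D_i, acts as n on m^n / m^(n+1), so
   w_i lies in every m^n and, by Krull, vanishes near the identity. By translation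
   w_i(x) = w_i(g) as soon as x is close to g, which makes A = Ann(w_i) + w_i A:
   the ideal w_i A is generated by an idempotent. That idempotent cuts out a union
   of connected components and vanishes at every rational point; as every component
   has a rational point, it is zero. *)
From HB Require Import structures.
Require Import Defs.
From mathcomp Require Import all_boot all_order all_algebra.
From mathcomp Require Import ring zify.
From mathcomp Require Import boolp classical_sets reals topology.
From mathcomp Require Import normedtype sequences exp.

Set Implicit Arguments.
Unset Strict Implicit.
Unset Printing Implicit Defensive.

Import Order.TTheory GRing.Theory Num.Theory numFieldNormedType.Exports.
Local Open Scope classical_set_scope.
Local Open Scope ring_scope.

(** * Projections onto finitely generated subspaces *)

(** By induction on the family: [Q] already fixes the other vectors. If it does not fix the new one,
    a linear form [g] that is 1 on it and kills the others corrects [Q]. This gives coordinates even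
    when V has infinite dimension and u is dependent. *)
Lemma finite_rank_projection (K : fieldType) (V : lmodType K) (n : nat)
    (u : 'I_n -> V) :
  exists phi : 'I_n -> {linear V -> K^o},
    forall j, \sum_k (phi k (u j) : K) *: u k = u j.
Proof.
elim: n u => [|n IH] u; first by exists (fun _ => \0) => -[].
have [phi phiE] := IH (fun i => u (lift ord0 i)).
pose Q v := \sum_k (phi k v : K) *: u (lift ord0 k).
have Plin : linear (fun v => v - Q v).
  move=> k x y; rewrite /Q scalerBr scaler_sumr addrACA -opprD -big_split /=.
  congr (_ - _); apply: eq_bigr => i _.
  by rewrite linearP scalerDl scalerA.
have [Qu0|Qu0] := eqVneq (u ord0 - Q (u ord0)) 0.
  exists (fun k => if unlift ord0 k is Some i then phi i else \0).
  move=> j; rewrite big_ord_recl unlift_none scale0r add0r.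
  under eq_bigr do rewrite liftK.
  case: (unliftP ord0 j) => [i ->|->]; first exact: phiE.
  by apply/esym/eqP; rewrite -subr_eq0; apply/eqP.
have [f [flin f1]] := functional_exists Qu0.
pose g : {linear V -> K^o} := HB.pack (fun v => f (v - Q v) : K^o)
  (GRing.isLinear.Build K V K^o *:%R (fun v => f (v - Q v))
     (fun k x y => etrans (congr1 f (Plin k x y)) (flin k (x - Q x) (y - Q y)))).
exists (fun k => if unlift ord0 k is Some i return {linear V -> K^o}
                 then phi i \- (phi i (u ord0) : K) \*: g else g).
have f0 : f 0 = 0.
  by have := flin (-1) 0 0; rewrite scaleN1r addNr scaleN1r addNr.
move=> j; rewrite big_ord_recl unlift_none.
have E i : (((phi i \- (phi i (u ord0) : K) \*: g : {linear V -> K^o}) (u j)) : K)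
      *: u (lift ord0 i) =
    (phi i (u j) : K) *: u (lift ord0 i)
      - (g (u j) : K) *: ((phi i (u ord0) : K) *: u (lift ord0 i)).
  by rewrite scalerA mulrC -scalerBl.
under eq_bigr do rewrite liftK E.
rewrite sumrB -scaler_sumr -!/(Q _).
case: (unliftP ord0 j) => [i ->|->]; last first.
  by rewrite [g _]f1 !scale1r subrr addr0.
have -> : g (u (lift ord0 i)) = 0 by rewrite /g /= /Q phiE subrr.
by rewrite !scale0r subr0 add0r [LHS]phiE.
Qed.

(** * Noetherian rings *)

(** A sequential form of the ascending chain condition, ready to be applied to the sequence [w T^n]
    in the Rees algebra. *)
Definition noetherian (T : comNzRingType) : Prop :=
  forall f : nat -> T, exists N (r : nat -> T), f N = \sum_(i < N) r i * f i.

Lemma noetherian_field (K : fieldType) : noetherian K.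
Proof.
move=> f; have [f0|f0] := eqVneq (f 0) 0.
  by exists 0%N, (fun=> 0); rewrite big_ord0.
by exists 1%N, (fun=> f 1%N / f 0%N); rewrite big_ord1 divfK.
Qed.

Definition comb (T : comNzRingType) (f : nat -> T) N (x : T) :=
  exists r : nat -> T, x = \sum_(i < N) r i * f i.

Section Comb.
Variables (T : comNzRingType) (f : nat -> T).

Lemma comb0 N : comb f N 0.
Proof. by exists (fun=> 0); rewrite big1 // => i _; rewrite mul0r. Qed.

Lemma combD N x y : comb f N x -> comb f N y -> comb f N (x + y).
Proof.
move=> [r ->] [s ->]; exists (fun i => r i + s i).
by rewrite -big_split; apply: eq_bigr => i _; rewrite mulrDl.
Qed.

Lemma combM N a x : comb f N x -> comb f N (a * x).
Proof.
move=> [r ->]; exists (fun i => a * r i).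
by rewrite mulr_sumr; apply: eq_bigr => i _; rewrite mulrA.
Qed.

Lemma combS N x : comb f N.+1 x <-> exists a y, comb f N y /\ x = y + a * f N.
Proof.
split=> [[r ->]|[a [y [[r ->] ->]]]].
  exists (r N), (\sum_(i < N) r i * f i); split; first by exists r.
  by rewrite big_ord_recr.
exists (fun i => if i == N then a else r i); rewrite big_ord_recr /= eqxx.
by congr (_ + _); apply: eq_bigr => i _; rewrite ltn_eqF.
Qed.

Lemma comb_le M N x : (M <= N)%N -> comb f M x -> comb f N x.
Proof.
move=> /subnK <-; elim: (N - M)%N => // k IH /IH H.
by rewrite addSn; apply/combS; exists 0, x; rewrite mul0r addr0.
Qed.

Lemma comb_last N : comb f N.+1 (f N).
Proof. by apply/combS; exists 1, 0; rewrite mul1r add0r; split=> //; exact: comb0. Qed.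

End Comb.

(** Hilbert's basis theorem. In the ideal [I] generated by a bad sequence, pick successively
    elements [g n] of least degree outside the ideal of the previous ones; a relation between their
    leading coefficients produces an element of smaller degree. *)
Lemma noetherian_poly (T : comNzRingType) :
  noetherian T -> noetherian {poly T}.
Proof.
move=> noethT f; apply: contrapT => nf.
have fN N : ~ comb f N (f N) by move=> [r E]; apply: nf; exists N, r.
pose I x := exists N, comb f N x.
have ID x y : I x -> I y -> I (x + y).
  move=> [M Mx] [N Ny]; exists (maxn M N); apply: combD.
    exact: comb_le (leq_maxl M N) Mx.
  exact: comb_le (leq_maxr M N) Ny.
have IM a x : I x -> I (a * x) by move=> [N Nx]; exists N; exact: combM.
pose fin (J : {poly T} -> Prop) := exists N, forall x, J x -> comb f N x.
(* [fin J] guarantees that [I] is not contained in [J]: some [f N] is missing. *)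
have next_ex (J : {poly T} -> Prop) : exists x, fin J ->
    [/\ I x, ~ J x & forall y, I y -> ~ J y -> (size x <= size y)%N].
  have [finJ|] := EM (fin J); last by exists 0.
  pose P n := `[< exists x, [/\ I x, ~ J x & size x = n] >].
  have exP : exists n, P n.
    case: finJ => N JN; exists (size (f N)); apply/asboolP; exists (f N).
    split=> //; last by move/JN/fN.
    by exists N.+1; exact: comb_last.
  case: (ex_minnP exP) => m /asboolP[x [Ix Jx <-]] xmin; exists x => _.
  by split=> // y Iy Jy; apply: xmin; apply/asboolP; exists y.
have [next nextP] := choice next_ex.
pose J := fix J n := if n is m.+1
  then fun x => exists a y, J m y /\ x = y + a * next (J m) else fun x => x = 0.
pose g n := next (J n).
have JE n x : J n x <-> comb g n x.
  elim: n x => [|n IH] x /=.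
    split=> [->|[r ->]]; last by rewrite big_ord0.
    exact: comb0.
  split=> [[a [y [/IH Jy ->]]]|]; first by apply/combS; exists a, y.
  by move=> /combS[a [y [/IH Jy ->]]]; exists a, y.
have finJ n : fin (J n).
  elim: n => [|n [N JN]]; first by exists 0%N => x ->; exact: comb0.
  have [|[M Mg] _ _] := nextP (J n); first by exists N.
  exists (maxn M N) => _ [a [y [/JN Jy ->]]]; apply: combD.
    exact: comb_le (leq_maxr M N) Jy.
  by apply: combM; exact: comb_le (leq_maxl M N) Mg.
have gI n : I (g n) by case: (nextP _ (finJ n)).
have gJ n : ~ comb g n (g n) by move/JE; case: (nextP _ (finJ n)).
have gmin n y : I y -> ~ comb g n y -> (size (g n) <= size y)%N.
  move=> Iy gy; case: (nextP _ (finJ n)) => _ _; apply=> // /JE.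
  exact: gy.
have gsize i n : (i <= n)%N -> (size (g i) <= size (g n))%N.
  by move=> le_in; apply: gmin => // /(comb_le le_in); exact: gJ.
have [N [r rE]] := noethT (fun n => lead_coef (g n)).
(* The powers of X raise every [g i] to the degree of [g N], so that [s] and [g N] have the same
   leading term. *)
pose h i := r i *: 'X^(size (g N) - size (g i)) : {poly T}.
pose s := \sum_(i < N) h i * g i.
have gN0 : (0 < size (g N))%N.
  by rewrite lt0n size_poly_eq0; apply/eqP => gN; apply: (gJ N); rewrite gN; exact: comb0.
have Ncs : comb g N s by exists h.
have Is : I s.
  rewrite /s; elim/big_ind: _ => //; first by exists 0%N; exact: comb0.
  by move=> i _; exact: IM.
have := gmin N (g N - s); rewrite leqNgt => H; apply: (elimN idP (H _ _)).
- by apply: ID => //; rewrite -mulN1r; exact: IM.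
- by move=> Hc; apply: (gJ N); rewrite -(subrK s (g N)); exact: combD.
rewrite -(prednK gN0) ltnS; apply/leq_sizeP => j le_j.
rewrite coefB /s coef_sum.
have E (i : 'I_N) : (h i * g i)`_j =
    if j == (size (g N)).-1 then r i * lead_coef (g i) else 0.
  rewrite -scalerAl coefZ coefXnM.
  have := gsize i N (ltnW (ltn_ord i)).
  have gi0 : (0 < size (g i))%N.
    rewrite lt0n size_poly_eq0; apply/eqP => gi.
    by apply: (gJ i); rewrite gi; exact: comb0.
  case: eqP => [-> | /eqP jN] le_iN.
    rewrite ltnNge -subn1 leq_sub2l //= /lead_coef; congr (_ * _`_ _).
    by rewrite -subn1; move: (size (g N)) (size (g i)) gi0 le_iN => a b; lia.
  case: ifP => _; rewrite ?mulr0 // nth_default ?mulr0 //.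
  by move: (size (g N)) (size (g i)) jN le_j gi0 le_iN => a b; lia.
rewrite (eq_bigr _ (fun i _ => E i)); case: eqP => [->|/eqP jN].
  by rewrite -rE subrr.
rewrite big1 // subr0 nth_default //; move: (size _) jN le_j gN0 => a; lia.
Qed.

(** T is an iterated polynomial ring, with one variable for each element of s. Its image is the
    subalgebra generated by s; the last clause is induction on that image, so the subalgebra never
    has to be built as a ring. *)
Lemma noetherian_cover (K : fieldType) (B : comNzRingType)
    (f : {rmorphism K -> B}) (s : seq B) :
  exists (T : comNzRingType) (phi : {rmorphism T -> B}),
    [/\ noetherian T, forall k, exists t, phi t = f k,
        {in s, forall b, exists t, phi t = b} &
        forall S : B -> Prop,
          (forall x y, S x -> S y -> S (x + y)) ->
          (forall x y, S x -> S y -> S (x * y)) ->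
          (forall k, S (f k)) -> {in s, forall b, S b} -> forall t, S (phi t)].
Proof.
elim: s => [|b s [T [phi [noethT phif phis phiS]]]].
  exists K, f; split=> // [|k]; first exact: noetherian_field.
  by exists k.
have cb : commr_rmorph phi b by move=> t; exact: mulrC.
pose psi : {rmorphism {poly T} -> B} := horner_morph cb.
have psiC t : psi t%:P = phi t by exact: horner_morphC.
have psiX : psi 'X = b by exact: horner_morphX.
exists {poly T}, psi; split.
- exact: noetherian_poly.
- by move=> k; have [t <-] := phif k; exists t%:P; rewrite psiC.
- move=> c; rewrite inE => /predU1P[->|/phis[t <-]].
    by exists 'X.
  by exists t%:P; rewrite psiC.
move=> S SD SM Sf Ss.
have Sphi : forall t, S (phi t).
  by apply: phiS => // c cs; apply: Ss; rewrite inE cs orbT.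
have Sb : S b by apply: Ss; exact: mem_head.
have S0 : S 0 by rewrite -(rmorph0 f).
elim/poly_ind => [|p t IH]; first by rewrite rmorph0.
by rewrite rmorphD rmorphM psiX psiC; apply: SD => //; exact: SM.
Qed.

(** * The augmentation ideal *)

(* the n-th power of the ideal m *)
Inductive ipow (A : comNzRingType) (m : A -> Prop) : nat -> A -> Prop :=
| ipow0 a : ipow m 0 a
| ipowM n x y : m x -> ipow m n y -> ipow m n.+1 (x * y)
| ipow_zero n : ipow m n 0
| ipowD n x y : ipow m n x -> ipow m n y -> ipow m n (x + y).

Definition augm (K : fieldType) (A : comAlgType K) (e : rational_point A) (a : A) :
  Prop := e a = 0.

Section AugmentationIdeal.
Variables (K : fieldType) (A : comAlgType K) (e : rational_point A).

Local Notation m := (augm e).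

Lemma rational_pointA k : e k%:A = k.
Proof. by rewrite linearZ /= rmorph1; exact: mulr1. Qed.

Lemma augm_sub a : m (a - (e a : K)%:A).
Proof. by rewrite /augm rmorphB /= rational_pointA subrr. Qed.

Lemma ipow_mull n c a : ipow m n a -> ipow m n (c * a).
Proof.
elim=> [*|k x y mx _ IH|k|k x y _ IHx _ IHy].
- exact: ipow0.
- by rewrite mulrCA; exact: ipowM.
- by rewrite mulr0; exact: ipow_zero.
- by rewrite mulrDr; exact: ipowD.
Qed.

Lemma ipow_scale n k a : ipow m n a -> ipow m n (k *: a).
Proof. by move=> Ha; rewrite -mulr_algl; exact: ipow_mull. Qed.

Lemma ipowN n a : ipow m n a -> ipow m n (- a).
Proof. by move=> Ha; rewrite -scaleN1r; exact: ipow_scale. Qed.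

Lemma ipowB n a b : ipow m n a -> ipow m n b -> ipow m n (a - b).
Proof. by move=> Ha Hb; apply: ipowD => //; exact: ipowN. Qed.

Lemma ipow1 a : ipow m 1 a <-> m a.
Proof.
split=> [|ma]; last by rewrite -[a]mulr1; apply: ipowM => //; exact: ipow0.
have H n b : ipow m n b -> (0 < n)%N -> m b; last by move/H; exact.
elim=> // [k x y mx _ _ _|k _|k x y _ IHx _ IHy k1].
- by rewrite /augm rmorphM /= mx mul0r.
- by rewrite /augm rmorph0.
- by rewrite /augm rmorphD /= [e x]IHx // [e y]IHy // addr0.
Qed.

Lemma ipow_mul i j a b : ipow m i a -> ipow m j b -> ipow m (i + j) (a * b).
Proof.
move=> Ha Hb; elim: Ha => [c|k x y mx _ IH|k|k x y _ IHx _ IHy].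
- exact: ipow_mull.
- by rewrite -mulrA addSn; exact: ipowM.
- by rewrite mul0r; exact: ipow_zero.
- by rewrite mulrDl; exact: ipowD.
Qed.

Lemma ipow_sum n (I : Type) (r : seq I) (F : I -> A) :
  (forall i, ipow m n (F i)) -> ipow m n (\sum_(i <- r) F i).
Proof.
move=> H; elim/big_ind: _ => //; first exact: ipow_zero.
by move=> *; exact: ipowD.
Qed.

Let x a : A := a - (e a : K)%:A.

Let xlin k a b : x (k *: a + b) = k *: x a + x b.
Proof. by rewrite /x linearP /= scalerBr scalerA scalerDl opprD addrACA. Qed.

Hypothesis A_fg : finitely_generated A.

(** The elements satisfying [P], made boolean by classical logic, form a subalgebra. *)
Lemma fg_ind : exists s : seq A, forall P : A -> Prop,
  {in s, forall a, P a} -> P 1 ->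
  (forall k a b, P a -> P b -> P (k *: a + b)) ->
  (forall a b, P a -> P b -> P (a * b)) -> forall a, P a.
Proof.
have [s sE] := A_fg; exists s => P Ps P1 Plin PM a.
pose S : {pred A} := [pred a | `[< P a >]].
have SP b : b \in S <-> P b by split=> [/asboolP|Pb] //; apply/asboolP.
apply/SP; apply: sE a => [|b /Ps/SP //].
split=> [|k u v /SP Pu /SP Pv|u v /SP Pu /SP Pv]; apply/SP => //.
- exact: Plin.
- exact: PM.
Qed.

(* The Rees algebra of m is Noetherian, so w T^N lies in the ideal generated by
   the w T^i with i < N; comparing the coefficients of T^N gives w = a w with
   a in m. *)
Lemma krull_intersection w :
  (forall n, ipow m n w) -> exists2 b, e b = 1 & b * w = 0.
Proof.
move=> Hw; have [s genP] := fg_ind.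
pose f : {rmorphism K -> {poly A}} := @polyC A \o in_alg A.
have [T [phi [noethT phif phis phiS]]] := noetherian_cover f
  ([seq a%:P | a <- s] ++ [seq (x a)%:P * 'X | a <- s]).
(* [im] describes the Rees algebra A + m T + m^2 T^2 + ...; the formula for [x (a * b)] below shows
   why finitely many [x a T] generate it over A. *)
pose im p := exists t, phi t = p.
have imD p q : im p -> im q -> im (p + q).
  by move=> [t <-] [u <-]; exists (t + u); rewrite rmorphD.
have imM p q : im p -> im q -> im (p * q).
  by move=> [t <-] [u <-]; exists (t * u); rewrite rmorphM.
have im0 : im 0 by exists 0; rewrite rmorph0.
have imZ k : im (k%:A)%:P by exact: phif.
have imC : forall a, im a%:P.
  apply: genP => [a sa|||].
  - by apply: phis; rewrite mem_cat; apply/orP; left; apply/mapP; exists a.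
  - by exists 1; rewrite rmorph1.
  - by move=> k a b Pa Pb; rewrite -mulr_algl polyCD polyCM; apply: imD => //; exact: imM.
  - by move=> a b Pa Pb; rewrite polyCM; exact: imM.
have imX : forall a, im ((x a)%:P * 'X).
  apply: genP => [a sa|||].
  - by apply: phis; rewrite mem_cat; apply/orP; right; apply/mapP; exists a.
  - by rewrite /x rmorph1 scale1r subrr mul0r.
  - move=> k a b Pa Pb.
    rewrite xlin -mulr_algl.
    rewrite polyCD polyCM mulrDl -mulrA; apply: imD => //; exact: imM.
  - move=> a b Pa Pb.
    have -> : x (a * b) = b * x a + (e a : K)%:A * x b.
      rewrite /x rmorphM /= mulrBr mulr_algl mulr_algr scalerBr scalerA.
      by rewrite [RHS]addrA subrK mulrC.
    rewrite polyCD !polyCM mulrDl -!mulrA.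
    by apply: imD; apply: imM.
have imn n a : ipow m n a -> im (a%:P * 'X^n).
  elim=> [b|k y z my _ IH|k|k y z _ IHy _ IHz].
  - by rewrite mulr1.
  - have -> : y = x y by rewrite /x [e y]my scale0r subr0.
    rewrite polyCM exprS mulrACA; exact: imM.
  - by rewrite mul0r.
  - by rewrite polyCD mulrDl; exact: imD.
have [P PE] := choice (fun n => imn n w (Hw n)).
have [N [r rE]] := noethT P.
have coefm : forall t k, m (phi t)`_k.+1.
  apply: (phiS (fun p => forall k, m p`_k.+1)) => [p q Hp Hq k|p q Hp Hq k|c k|p].
  - by rewrite /augm coefD rmorphD /= [e _]Hp [e _]Hq addr0.
  - rewrite /augm coefM rmorph_sum big1 // => -[[|i] /= le_i] _.
      by rewrite subn0 rmorphM /= [e q`__]Hq mulr0.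
    by rewrite rmorphM /= [e p`__]Hp mul0r.
  - by rewrite /augm /f /= coefC rmorph0.
  - rewrite mem_cat => /orP[] /mapP[a _ ->] k; rewrite /augm.
      by rewrite coefC rmorph0.
    rewrite coefMX coefC; case: k => [|k] /=; last exact: rmorph0.
    exact: augm_sub.
(* The subtracted coefficients have degree N - i > 0, so they lie in m by [coefm]. *)
exists (1 - \sum_(i < N) (phi (r i))`_(N - i)).
  rewrite rmorphB rmorph1 rmorph_sum big1 ?subr0 // => -[i /= lt_iN] _.
  by rewrite -[(N - i)%N]prednK ?subn_gt0 //; exact: coefm.
have := congr1 (fun p => (phi p)`_N) rE.
rewrite PE coefCM coefXn eqxx mulr1 rmorph_sum coef_sum => wE.
rewrite mulrBl mul1r mulr_suml {1}wE; apply/eqP; rewrite subr_eq0; apply/eqP.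
apply: eq_bigr => i _; rewrite rmorphM PE mulrA coefMXn ltnNge (ltnW (ltn_ord i)) /=.
by rewrite coefMC.
Qed.

Definition point_derivation (delta : A -> K^o) : Prop :=
  forall a b, delta (a * b) = e a * delta b + delta a * e b.

Let xM a b : x (a * b) = x a * x b + ((e b : K) *: x a + (e a : K) *: x b).
Proof.
have uv : (e (a * b) : K)%:A = (e a : K)%:A * (e b : K)%:A :> A.
  by rewrite mulr_algl scalerA rmorphM.
by rewrite -![_ *: x _]mulr_algl /x uv; ring.
Qed.

(* y is a basis of m modulo m^2: a spanning family of minimal size. *)
Lemma cotangent_basis : exists n (y : 'I_n -> A) (delta : 'I_n -> {linear A -> K^o}),
  [/\ forall i, e (y i) = 0, forall i, point_derivation (delta i) &
      forall a, ipow m 2 (a - (e a : K)%:A - \sum_i (delta i a : K) *: y i)].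
Proof.
pose Q n (y : 'I_n -> A) a := exists c : 'I_n -> K, ipow m 2 (x a - \sum_i c i *: y i).
have Qlin n (y : 'I_n -> A) k a b c d :
    ipow m 2 (x a - \sum_i c i *: y i) -> ipow m 2 (x b - \sum_i d i *: y i) ->
    ipow m 2 (x (k *: a + b) - \sum_i (k * c i + d i) *: y i).
  move=> /(ipow_scale k) Ha Hb; have := ipowD Ha Hb.
  rewrite xlin scalerBr scaler_sumr addrACA -opprD -big_split /=.
  by under eq_bigr do rewrite scalerA -scalerDl.
(* The cross term [x a * x b] lies in m^2, hence the coordinates modulo m^2 obey the Leibniz
   rule. *)
have QM n (y : 'I_n -> A) a b c d :
    ipow m 2 (x a - \sum_i c i *: y i) -> ipow m 2 (x b - \sum_i d i *: y i) ->
    ipow m 2 (x (a * b) - \sum_i (e a * d i + c i * e b) *: y i).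
  move=> /(ipow_scale (e b)) Ha /(ipow_scale (e a)) Hb.
  have xx : ipow m 2 (x a * x b).
    by apply: (@ipow_mul 1 1); apply/ipow1; exact: augm_sub.
  have := ipowD xx (ipowD Ha Hb).
  rewrite xM !scalerBr !scaler_sumr addrACA -opprD addrA -big_split /=.
  under eq_bigr do rewrite !scalerA -scalerDl addrC [e b * _]mulrC.
  by [].
pose P n := `[< exists y : 'I_n -> A, (forall i, m (y i)) /\ forall a, Q n y a >].
have exP : exists n, P n.
  have [s genP] := fg_ind.
  exists (size s); apply/asboolP; exists (fun i => x (tnth (in_tuple s) i)).
  split=> [i|]; first exact: augm_sub.
  apply: genP => [a /(tnthP (in_tuple s))[i ->]||k a b [c Hc] [d Hd]|a b [c Hc] [d Hd]].
  - exists (fun j => (j == i)%:R); rewrite (bigD1 i) //= eqxx scale1r big1.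
      by rewrite addr0 subrr; exact: ipow_zero.
    by move=> j /negbTE->; rewrite scale0r.
  - exists (fun=> 0); rewrite big1 => [|i _]; last by rewrite scale0r.
    by rewrite /x rmorph1 scale1r subrr subr0; exact: ipow_zero.
  - by exists (fun i => k * c i + d i); exact: Qlin.
  - by exists (fun i => e a * d i + c i * e b); exact: QM.
case: (ex_minnP exP) => n /asboolP[y [my yQ]] nmin.
have free c : ipow m 2 (\sum_i c i *: y i) -> forall j, c j = 0.
  move=> Hc j; apply/eqP/negP => /negP cj.
  case: n y my yQ nmin c j Hc cj => [|n] y my yQ nmin c j Hc cj; first by case: j {cj}.
  suff /nmin : P n by rewrite ltnn.
  apply/asboolP; exists (fun i => y (lift j i)); split=> // a.
  have [d Hd] := yQ a.
  (* If [c j] is nonzero, the relation expresses [y j] through the others modulo m^2; substituting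
     it leaves these coordinates and contradicts the minimality of n. *)
  exists (fun i => d (lift j i) - d j / c j * c (lift j i)).
  have := ipowD Hd (ipow_scale (d j / c j) Hc).
  rewrite !(bigD1_ord j) //= scalerDr scalerA divfK // scaler_sumr.
  under [in X in _ -> X]eq_bigr do rewrite scalerBl -scalerA.
  by rewrite sumrB; congr (ipow m 2 _); ring.
(* The coordinates are chosen arbitrarily, but [free] makes them unique; linearity and the Leibniz
   rule then follow from [Qlin] and [QM]. *)
have [c cP] := choice yQ.
have cU a d : ipow m 2 (x a - \sum_i d i *: y i) -> forall i, c a i = d i.
  move=> Hd i; apply/eqP; rewrite -subr_eq0; apply/eqP.
  apply: (free (fun i => c a i - d i)).
  under eq_bigr do rewrite scalerBl.
  rewrite sumrB; have := ipowB Hd (cP a).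
  by rewrite opprB addrC subrKA.
have clin i : linear (fun a => c a i : K^o).
  by move=> k a b; apply: (cU _ (fun i => k * c a i + c b i)); exact: Qlin.
pose delta i : {linear A -> K^o} := HB.pack (fun a => c a i : K^o)
  (GRing.isLinear.Build K A K^o *:%R (fun a => c a i : K^o) (clin i)).
exists n, y, delta; split=> // i a b.
by apply: (cU _ (fun i => e a * c b i + c a i * e b)); exact: QM.
Qed.

End AugmentationIdeal.

(** * Convolution by linear forms *)

Definition tlin (K : fieldType) (A B M : lmodType K) (f : A -> B -> M)
    (hf : is_bilinear f) : {linear A ⊗ B -> M} :=
  HB.pack (tlift f)
    (GRing.isLinear.Build K (A ⊗ B) M *:%R (tlift f) (tlift_is_linear hf)).

Section RightAction.
Variables (K : fieldType) (A : comHopfType K).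

Lemma comul_sum (a : A) : comul a = \sum_(p <- repr (comul a)) p.1 ⊗t p.2.
Proof. exact: tensor_sum. Qed.

(* Both sides are \sum f(c_1, c_2) ⊗ c_3. *)
Lemma comulA_bilinear (f : A -> A -> A) c : is_bilinear f ->
  tlift (fun x y => tlift (fun y z => f x y ⊗t z) (comul y)) (comul c) =
  tlift (fun x y => tlift f (comul x) ⊗t y) (comul c).
Proof.
move=> hf.
have ht := tens_is_bilinear A A.
have hg x : is_bilinear (fun y z : A => f x y ⊗t z).
  split=> [z k u v|y k u v] /=; last by rewrite ht.2.
  by rewrite hf.2 ht.1.
have hG : is_bilinear (fun x (t : A ⊗ A) => tlift (fun y z : A => f x y ⊗t z) t).
  split=> [t k u v|x]; last exact: tlift_is_linear.
  rewrite /= /tlift /tsum scaler_sumr -big_split; apply: eq_bigr => p _.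
  by rewrite hf.1 ht.1.
pose G := tlin hG.
(* Seen as an algebra morphism, [tassoc] commutes with sums. *)
pose T : {lrmorphism (A ⊗ A) ⊗ A -> A ⊗ (A ⊗ A)} := tcopair
  (tcopair (@tinl K A (A ⊗ A)) (@tinr K A (A ⊗ A) \o @tinl K A A))
  (@tinr K A (A ⊗ A) \o @tinr K A A).
have TE x : tassoc x = T x by exact: tassoc_tcopair.
have TE3 x y z : T ((x ⊗t y) ⊗t z) = x ⊗t (y ⊗t z) by rewrite -TE tassocE.
have TD u v : T (u + v) = T u + T v by exact: raddfD.
have GD u v : G (u + v) = G u + G v by exact: raddfD.
have Tsum I (r : seq I) (H : I -> (A ⊗ A) ⊗ A) :
  T (\sum_(i <- r) H i) = \sum_(i <- r) T (H i) by exact: raddf_sum.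
have Gsum I (r : seq I) (H : I -> A ⊗ (A ⊗ A)) :
  G (\sum_(i <- r) H i) = \sum_(i <- r) G (H i) by exact: raddf_sum.
have GE x t : G (x ⊗t t) = tlift (fun y z : A => f x y ⊗t z) t by rewrite /G /= tliftE.
pose fl := tlin hf.
have flD u v : fl (u + v) = fl u + fl v by exact: raddfD.
have flE x y : fl (x ⊗t y) = f x y by rewrite /fl /= tliftE.
have GT t z : G (T (t ⊗t z)) = fl t ⊗t z.
  elim/tensor_ind: t => [|x y t IH].
    by rewrite (bilin0l (tens_is_bilinear _ _)) !raddf0 (bilin0l ht).
  rewrite (bilinDl (tens_is_bilinear _ _)) TD GD flD (bilinDl ht) -IH.
  congr (_ + _).
  by rewrite TE3 GE flE tliftE.
have := congr1 G (comulA c).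
have -> : tmap comul id (comul c) =
    \sum_(p <- repr (comul c)) comul p.1 ⊗t p.2.
  rewrite [in LHS]comul_sum (tmap_sum _ (@idfun A)).
  by apply: eq_bigr => p _; rewrite (tmapE _ (@idfun A)).
have -> : tmap id comul (comul c) =
    \sum_(p <- repr (comul c)) p.1 ⊗t comul p.2.
  rewrite [in LHS]comul_sum (tmap_sum (@idfun A)).
  by apply: eq_bigr => p _; rewrite (tmapE (@idfun A)).
rewrite TE Tsum !Gsum => E; apply/esym.
rewrite /tlift /tsum; etransitivity; last first.
  by etransitivity; first exact: E; apply: eq_bigr => p _; rewrite GE.
by apply: eq_bigr => p _; rewrite GT.
Qed.

Implicit Types (phi psi : {linear A -> K^o}) (a b : A).

(* (id ⊗ phi) \o comul *)
Definition ract phi a : A := tlift (fun x y => (phi y : K) *: x) (comul a).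

Lemma ract_bilinear (M : lmodType K) phi :
  is_bilinear (fun (x : M) y => (phi y : K) *: x).
Proof.
split=> [y k u v|x k u v] /=.
  by rewrite scalerDr !scalerA mulrC.
by rewrite linearP scalerDl scalerA.
Qed.

Lemma ract_is_linear phi : linear (ract phi).
Proof.
by move=> k a b; rewrite /ract linearP (tlift_is_linear (ract_bilinear A phi)).
Qed.
HB.instance Definition _ phi :=
  GRing.isLinear.Build K A A *:%R (ract phi) (ract_is_linear phi).

Lemma counit_ract phi a : counit (ract phi a) = phi a.
Proof.
rewrite -[in RHS](comul_counitl a) /ract /tlift /tsum !linear_sum.
by apply: eq_bigr => p _; rewrite !linearZ /= [LHS]mulrC.
Qed.

Lemma ract_counit a : ract (@counit K A) a = a.
Proof. exact: comul_counitr. Qed.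

(** Coassociativity: [phi \o ract psi] is the convolution product (phi ⊗ psi) \o comul. *)
Lemma ract_ract phi psi a : ract phi (ract psi a) = ract (phi \o ract psi) a.
Proof.
pose f x y := (phi y : K) *: x.
pose R (chi : {linear A -> K^o}) := tlin (ract_bilinear A chi).
have RE chi x y : R chi (x ⊗t y) = (chi y : K) *: x.
  by rewrite /R /= tliftE //; exact: ract_bilinear.
have Rsum chi I (r : seq I) (G : I -> A ⊗ A) :
  R chi (\sum_(i <- r) G i) = \sum_(i <- r) R chi (G i) by exact: raddf_sum.
have ractE chi b : ract chi b = \sum_(p <- repr (comul b)) (chi p.2 : K) *: p.1 by [].
have := congr1 (R psi) (comulA_bilinear a (ract_bilinear A phi)).
rewrite /tlift /tsum !Rsum => E.
transitivity (\sum_(p <- repr (comul a)) (psi p.2 : K) *: ract phi p.1).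
  by rewrite [in LHS](ractE psi) linear_sum; apply: eq_bigr => p _; rewrite linearZ.
transitivity (\sum_(p <- repr (comul a)) R psi (ract phi p.1 ⊗t p.2)).
  by apply: eq_bigr => p _; rewrite RE.
rewrite -[LHS]E [RHS]ractE; apply: eq_bigr => p _.
rewrite Rsum [in RHS]/= (ractE psi) linear_sum scaler_suml.
by apply: eq_bigr => q _; rewrite RE scalerA linearZ.
Qed.

(** All iterates are again convolutions, so every one of them sends a into the span of the left
    factors of the same tensor [comul a]. *)
Lemma iter_ract (delta : {linear A -> K^o}) n a :
  exists2 phi : {linear A -> K^o}, (forall a, phi a = counit (iter n (ract delta) a))
    & forall a, iter n (ract delta) a = ract phi a.
Proof.
elim: n a => [|n IH] a; first by exists counit => // b; rewrite ract_counit.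
have [phi phiE rE] := IH a.
exists (phi \o ract delta) => b; rewrite iterSr; first by rewrite /= phiE.
by rewrite rE ract_ract.
Qed.

Lemma ract_derivation (delta : {linear A -> K^o}) a b :
  point_derivation (@counit K A) delta ->
  ract delta (a * b) = a * ract delta b + ract delta a * b.
Proof.
move=> Hdelta; pose R chi := tlin (ract_bilinear A chi).
have RE chi x y : R chi (x ⊗t y) = (chi y : K) *: x.
  by rewrite /R /= tliftE //; exact: ract_bilinear.
have RD chi u v : R chi (u + v) = R chi u + R chi v by exact: raddfD.
(* Before composition with [comul], [R delta] is a derivation along [R counit], which [comul] turns
   into the identity. *)
have H s t : R delta (s * t) = R counit s * R delta t + R delta s * R counit t.
  elim/tensor_ind: s => [|x y s IHs].
    by rewrite mul0r !raddf0 !mul0r addr0.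
  rewrite mulrDl !RD IHs !mulrDl addrACA; congr (_ + _).
  elim/tensor_ind: t {IHs} => [|x' y' t IHt].
    by rewrite mulr0 !raddf0 !mulr0 addr0.
  rewrite mulrDr !RD IHt !mulrDr addrACA; congr (_ + _).
  rewrite tensM !RE Hdelta scalerDl -!scalerAl -!scalerAr !scalerA.
  by [].
have comulM : comul (a * b) = comul a * comul b by exact: rmorphM.
have rE chi c : R chi (comul c) = ract chi c by [].
by rewrite -rE comulM H !rE !ract_counit.
Qed.

Lemma ract1 (delta : {linear A -> K^o}) :
  point_derivation (@counit K A) delta -> ract delta 1 = 0.
Proof.
move=> Hdelta; apply: (addrI (ract delta 1)); rewrite addr0 -[in RHS](mulr1 1).
by rewrite ract_derivation // mul1r mulr1.
Qed.

(* The images of a by the D^n lie in the span of the x_i, where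
   comul a = \sum_i x_i ⊗ y_i. *)
Lemma ract_locally_finite (delta : {linear A -> K^o}) a :
  exists r (x : 'I_r -> A) (t : 'I_r -> 'I_r -> K) (v : nat -> 'I_r -> K),
    (forall n k, v n.+1 k = \sum_j v n j * t j k) /\
    forall n, iter n (ract delta) a = \sum_j v n j *: x j.
Proof.
pose s := repr (comul a).
pose x i := (tnth (in_tuple s) i).1.
have [pi piE] := finite_rank_projection x.
(* D may move the span of the [x j], so t is D followed by the projection; this is enough because
   each [D^n a] stays in the span ([piD]). *)
pose t j k : K := pi k (ract delta (x j)).
pose v := fix v n k := if n is m.+1 then \sum_j v m j * t j k else pi k a : K.
exists (size s), x, t, v; split=> //.
have piD n : iter n (ract delta) a =
    \sum_k (pi k (iter n (ract delta) a) : K) *: x k.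
  have [phi _ ->] := iter_ract delta n a.
  have -> : ract phi a = \sum_j (phi (tnth (in_tuple s) j).2 : K) *: x j.
    by rewrite /ract /tlift /tsum big_tnth.
  under [RHS]eq_bigr do rewrite linear_sum scaler_suml.
  rewrite exchange_big; apply: eq_bigr => j _ /=.
  rewrite -[in LHS](piE j) scaler_sumr; apply: eq_bigr => k _.
  by rewrite scalerA linearZ.
elim=> [|n IH]; first exact: piD 0%N.
rewrite piD; apply: eq_bigr => k _; congr (_ *: _).
have DE : ract delta (\sum_j v n j *: x j) = \sum_j v n j *: ract delta (x j).
  by rewrite linear_sum; apply: eq_bigr => j _; rewrite linearZ.
rewrite iterS IH DE linear_sum; apply: eq_bigr => j _.
by rewrite linearZ.
Qed.

End RightAction.

(** * The exponential of a point derivation *)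

(** The Cauchy product up to N covers the triangle i + j < N of the square i, j < N. What is left is
    a plain sum of products, which can be bounded term by term. *)
Lemma product_series_rem (R : comNzRingType) (f g : nat -> R) N :
  (\sum_(0 <= i < N) f i) * (\sum_(0 <= j < N) g j)
    - \sum_(0 <= k < N) \sum_(0 <= i < k.+1) f i * g (k - i)%N =
  \sum_(0 <= i < N) \sum_(N - i <= j < N) f i * g j.
Proof.
have -> : \sum_(0 <= k < N) \sum_(0 <= i < k.+1) f i * g (k - i)%N =
    \sum_(0 <= i < N) \sum_(0 <= j < N - i) f i * g j.
  elim: N => [|N IH]; first by rewrite !big_geq.
  rewrite big_nat_recr //= IH.
  have E i : (0 <= i < N.+1)%N -> \sum_(0 <= j < N.+1 - i) f i * g j =
      \sum_(0 <= j < N - i) f i * g j + f i * g (N - i)%N.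
    by move=> /andP[_ iN]; rewrite subSn // big_nat_recr.
  rewrite [RHS](eq_big_nat _ _ E) big_split /=; congr (_ + _).
  by rewrite big_nat_recr //= subnn [X in _ + X]big_geq // addr0.
rewrite mulr_suml -sumrB; apply: eq_big_nat => i /andP[_ iN].
rewrite mulr_sumr (big_cat_nat (n := N - i)%N) //= ?leq_subr //.
by rewrite addrAC subrr add0r.
Qed.

Lemma exp_series_cvg (R : realType) (c x : R) :
  series (fun n => c * exp_coeff x n) @ \oo --> c * expR x.
Proof.
have -> : series (fun n => c * exp_coeff x n) = fun n => c * series (exp_coeff x) n.
  by apply/funext => n; rewrite /series /= mulr_sumr.
by apply: cvgMr; exact: is_cvg_series_exp_coeff.
Qed.

Section CauchyProduct.
Variables (R : realType) (f g : R^nat) (C M D L : R).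
Hypotheses (fle : forall n, `|f n| <= C * exp_coeff M n)
  (gle : forall n, `|g n| <= D * exp_coeff L n).

Let conv (u v : R^nat) : R^nat := fun k => \sum_(0 <= i < k.+1) u i * v (k - i)%N.

(** The binomial theorem, with the factorials absorbed in [exp_coeff]. *)
Let conv_exp : conv (fun n => C * exp_coeff M n) (fun n => D * exp_coeff L n) =
  (fun n => C * D * exp_coeff (M + L) n).
Proof.
apply/funext => k; rewrite /conv big_mkord.
transitivity (C * D * (\sum_(i < k.+1) exp_coeff M i * exp_coeff L (k - i)%N)).
  by rewrite mulr_sumr; apply: eq_bigr => i _; rewrite [LHS]mulrACA.
congr (_ * _); rewrite /exp_coeff /= addrC exprDn mulr_suml.
apply: eq_bigr => -[i /= ik] _; rewrite ltnS in ik.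
rewrite -mulr_natr -(bin_fact ik) !natrM; field.
by rewrite !pnatr_eq0 -!lt0n !fact_gt0 bin_gt0 ik.
Qed.

(* Domination by exponential series reduces the claim to expRD. *)
Lemma cauchy_product_cvg (a b : R) :
  series f @ \oo --> a -> series g @ \oo --> b ->
  series (fun k => \sum_(0 <= i < k.+1) f i * g (k - i)%N) @ \oo --> a * b.
Proof.
move=> fa gb; pose rem (u v : R^nat) : R^nat :=
  fun N => series u N * series v N - series (conv u v) N.
have remfg N : `|rem f g N| <= rem (fun n => C * exp_coeff M n) (fun n => D * exp_coeff L n) N.
  rewrite /rem !product_series_rem.
  rewrite (le_trans (ler_norm_sum _ _ _)) //; apply: ler_sum => i _.
  rewrite (le_trans (ler_norm_sum _ _ _)) //; apply: ler_sum => j _.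
  by rewrite normrM; apply: ler_pM.
have rem0 : rem (fun n => C * exp_coeff M n) (fun n => D * exp_coeff L n) @ \oo --> (0 : R).
  have -> : (0 : R) = (C * expR M) * (D * expR L) - C * D * expR (M + L).
    by rewrite expRD; ring.
  by rewrite /rem conv_exp; apply: cvgB; [apply: cvgM|]; exact: exp_series_cvg.
have rfg : rem f g @ \oo --> (0 : R).
  apply: norm_cvg0; apply: squeeze_cvgr (@cvg_cst _ _ _ _ _) rem0.
  by near=> n; rewrite remfg andbT.
have -> : series (fun k => \sum_(0 <= i < k.+1) f i * g (k - i)%N) =
    fun N => series f N * series g N - rem f g N.
  by apply/funext => N; rewrite /rem opprB addrC subrK.
by rewrite -[a * b]subr0; apply: cvgB => //; exact: cvgM.
Unshelve. all: by end_near. Qed.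

End CauchyProduct.

Section Exponential.
Variables (R : realType) (A : comHopfType R).

(** Leibniz's formula, by Pascal's rule. *)
Lemma iter_derivation (D : {linear A -> A}) :
  (forall a b, D (a * b) = a * D b + D a * b) ->
  forall n a b, iter n D (a * b) =
    \sum_(i < n.+1) (iter i D a * iter (n - i) D b) *+ 'C(n, i).
Proof.
move=> HD n a b; elim: n => [|n IH]; first by rewrite big_ord1.
have DMn x k : D (x *+ k) = D x *+ k by exact: raddfMn.
have S1 : \sum_(i < n.+1) (iter i D a * iter (n - i).+1 D b) *+ 'C(n, i) =
    a * iter n.+1 D b
      + \sum_(i < n.+1) (iter i.+1 D a * iter (n - i) D b) *+ 'C(n, i.+1).
  (* The added term of index n + 1 has binomial coefficient 0. *)
  transitivity (\sum_(i < n.+2) (iter i D a * iter (n.+1 - i) D b) *+ 'C(n, i)).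
    rewrite [RHS]big_ord_recr /= bin_small // mulr0n addr0.
    by apply: eq_bigr => -[i /= ik] _; rewrite subSn.
  by rewrite big_ord_recl /= bin0 mulr1n; congr (_ + _); apply: eq_bigr.
rewrite iterS IH linear_sum.
under eq_bigr do rewrite DMn HD mulrnDl.
rewrite big_split S1 -[LHS]addrA -[X in _ + X = _]big_split [RHS]big_ord_recl bin0 mulr1n.
congr (_ + _); apply: eq_bigr => i _.
by rewrite -[LHS]mulrnDr -binS.
Qed.

Variables (delta : {linear A -> R^o}).
Hypothesis Hdelta : point_derivation (@counit R A) delta.

Definition exp_term (a : A) (n : nat) : R :=
  (counit (iter n (ract delta) a) : R) / n`!%:R.

(** By local finiteness the coordinates of [D^n a] come from n applications of a fixed matrix, so
    they grow at most like the n-th power of M, the sum of the absolute values of its entries. *)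
Lemma exp_term_bound a :
  exists C M, forall n, `|exp_term a n| <= C * exp_coeff M n.
Proof.
have [r [x [t [v [vS vE]]]]] := ract_locally_finite delta a.
pose B n := \sum_k `|v n k|; pose M := \sum_j \sum_k `|t j k|.
have M0 : 0 <= M by apply: sumr_ge0 => j _; exact: sumr_ge0.
have B0 n : 0 <= B n by exact: sumr_ge0.
have BS n : B n.+1 <= B n * M.
  rewrite /B; under eq_bigr do rewrite vS.
  have H : \sum_k `|\sum_j v n j * t j k| <= \sum_k \sum_j `|v n j| * `|t j k|.
    apply: ler_sum => k _; rewrite (le_trans (ler_norm_sum _ _ _)) //.
    by apply: ler_sum => j _; rewrite normrM.
  apply: (le_trans H); rewrite exchange_big mulr_suml.
  apply: ler_sum => j _; rewrite -mulr_sumr ler_wpM2l //.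
  by rewrite /M [leRHS](bigD1 j) //= lerDl; apply: sumr_ge0 => i _; exact: sumr_ge0.
have BM n : B n <= B 0%N * M ^+ n.
  elim: n => [|n IH]; first by rewrite mulr1.
  by rewrite (le_trans (BS n)) // exprSr mulrA ler_wpM2r.
pose X := \sum_j `|counit (x j) : R|.
have X0 : 0 <= X by exact: sumr_ge0.
exists (B 0%N * X), M => n.
rewrite /exp_term normrM normfV normr_nat /exp_coeff /= mulrA.
rewrite ler_wpM2r ?invr_ge0 ?ler0n // vE linear_sum.
rewrite (le_trans (ler_norm_sum _ _ _)) //.
apply: (@le_trans _ _ (B n * X)); last by rewrite mulrAC ler_wpM2r.
rewrite mulr_suml; apply: ler_sum => j _.
rewrite linearZ normrM ler_wpM2l //.
by rewrite /X (bigD1 j) //= lerDl sumr_ge0.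
Qed.

Lemma exp_termM a b n :
  exp_term (a * b) n = \sum_(0 <= i < n.+1) exp_term a i * exp_term b (n - i)%N.
Proof.
rewrite /exp_term (iter_derivation (D := ract delta)); last first.
  by move=> *; exact: ract_derivation.
have cE (x y : A) k : counit ((x * y) *+ k) = counit x * counit y *+ k :> R.
  by rewrite raddfMn; congr (_ *+ _); exact: rmorphM.
rewrite big_mkord linear_sum mulr_suml; apply: eq_bigr => -[i /= ik] _.
rewrite ltnS in ik; rewrite cE -mulr_natr -(bin_fact ik) !natrM.
by field; rewrite !pnatr_eq0 -!lt0n !fact_gt0 bin_gt0 ik.
Qed.

Lemma exp_term_cvg a : cvgn (series (exp_term a)).
Proof.
have [C [M H]] := exp_term_bound a.
apply: (@normed_cvg _ R^o); apply: (series_le_cvg _ _ H) => [n|n|] /=.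
- exact: normr_ge0.
- exact: le_trans (normr_ge0 _) (H n).
exact: cvgP (@exp_series_cvg R C M).
Qed.

Definition exp_fun (a : A) : R^o := limn (series (exp_term a)).

Lemma exp_fun_cvg a : series (exp_term a) @ \oo --> (exp_fun a : R).
Proof. exact: exp_term_cvg. Qed.

Lemma exp_fun_linear : linear exp_fun.
Proof.
move=> k a b; apply: cvg_lim => //.
have -> : series (exp_term (k *: a + b)) =
    fun n => k * series (exp_term a) n + series (exp_term b) n.
  apply/funext => n; rewrite /series /= mulr_sumr -big_split; apply: eq_bigr => i _.
  rewrite /exp_term.
  have -> : iter i (ract delta) (k *: a + b) =
      k *: iter i (ract delta) a + iter i (ract delta) b.
    by elim: i => //= i ->; rewrite linearP.
  by rewrite linearP [LHS]mulrDl; congr (_ + _); exact: esym (mulrA _ _ _).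
apply: cvgD; last exact: exp_fun_cvg.
by apply: cvgMr; exact: exp_fun_cvg.
Qed.

(** At 1 only the term of index 0 survives, since D kills 1. Products are handled by Leibniz's
    formula and the Cauchy product. *)
Lemma exp_fun_monoid : monoid_morphism exp_fun.
Proof.
split.
  apply: lim_near_cst => //; near=> n.
  have /prednK <- : (0 < n)%N by near: n; exact: nbhs_infty_gt.
  rewrite /series /= big_nat_recl // big1 ?addr0.
    by rewrite /exp_term /= rmorph1 fact0 divr1.
  move=> i _; rewrite /exp_term iterSr ract1 //.
  have -> : iter i (ract delta) 0 = 0 by elim: i => //= i ->; rewrite raddf0.
  by rewrite raddf0 mul0r.
move=> a b; apply: cvg_lim => //.
have -> : exp_term (a * b) =
    fun n => \sum_(0 <= i < n.+1) exp_term a i * exp_term b (n - i)%N.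
  by apply/funext => n; exact: exp_termM.
have [C [M Ha]] := exp_term_bound a; have [D [L Hb]] := exp_term_bound b.
exact: (cauchy_product_cvg Ha Hb (@exp_fun_cvg a) (@exp_fun_cvg b)).
Unshelve. all: by end_near. Qed.

Lemma exp_point : exists g : rational_point A, forall a,
  series (fun n => (counit (iter n (ract delta) a) : R) / n`!%:R) @ \oo --> (g a : R).
Proof.
pose g : rational_point A := HB.pack exp_fun
  (GRing.isLinear.Build R A R^o *:%R exp_fun exp_fun_linear)
  (GRing.isMonoidMorphism.Build A R^o exp_fun exp_fun_monoid).
by exists g => a; exact: exp_fun_cvg.
Qed.

End Exponential.

(** * Functions constant on the rational points *)

Section ConstantOnPoints.
Variables (R : realType) (A : comHopfType R) (delta : {linear A -> R^o}).
Hypothesis Hdelta : point_derivation (@counit R A) delta.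

Lemma iter_ractZ t n a :
  iter n (ract (t \*: delta)) a = t ^+ n *: iter n (ract delta) a.
Proof.
have H b : ract (t \*: delta) b = t *: ract delta b.
  rewrite /ract /tlift /tsum scaler_sumr; apply: eq_bigr => p _.
  by rewrite scalerA.
elim: n => [|n IH]; first by rewrite scale1r.
by rewrite iterS IH H linearZ scalerA -exprS.
Qed.

(* Differentiates t |-> c (exp (t delta)) at t = 0. *)
Lemma point_derivation_eq0 (c : A) :
  (forall g : rational_point A, g c = counit c) -> delta c = 0.
Proof.
move=> gc; have [C [M uM]] := exp_term_bound delta c.
pose u := exp_term delta c.
have u0 : u 0%N = counit c by rewrite /u /exp_term divr1.
have u1 : u 1%N = delta c by rewrite /u /exp_term divr1 /= counit_ract.
(* The sum is the value of c at the rational point exp(t delta), hence [counit c] for every t. *)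
have cv t : series (fun n => t ^+ n * u n) @ \oo --> u 0%N.
  have Ht : point_derivation (@counit R A) (t \*: delta).
    move=> a b /=; rewrite Hdelta [LHS]mulrDr.
    by congr (_ + _); [exact: mulrCA|exact: mulrA].
  have [g gE] := exp_point Ht.
  rewrite u0 -(gc g); have := gE c.
  rewrite (_ : (fun n => _ / _) = (fun n => t ^+ n * u n)) //.
  by apply/funext => n; rewrite iter_ractZ linearZ [RHS]mulrA.
pose B := C * expR M.
have ule N : \sum_(0 <= n < N) `|u n| <= B.
  have H : nondecreasing_seq (series (fun n => C * exp_coeff M n)).
    by apply: nondecreasing_series => n _ _; exact: le_trans (uM n).
  have := nondecreasing_cvgn_le H (cvgP _ (@exp_series_cvg R C M)) N.
  rewrite (cvg_lim _ (@exp_series_cvg R C M)) //; apply: le_trans.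
  by apply: ler_sum => n _; exact: uM.
have B0 : 0 <= B by apply: le_trans (ule 0%N); rewrite big_geq.
(* Beyond the first two terms the series is at most [t^2 B], as t <= 1; since the whole sum is
   [u 0], this bounds [t * u 1], and one factor t cancels. *)
have bound t : 0 < t -> t <= 1 -> `|u 1%N| <= t * B.
  move=> t0 t1.
  rewrite -(ler_pM2l t0) -{1}(ger0_norm (ltW t0)) -normrM.
  have cv' : (fun N => `|series (fun n => t ^+ n * u n) N - (u 0%N + t * u 1%N)|)
      @ \oo --> `|t * u 1%N|.
    have -> : `|t * u 1%N| = `|u 0%N - (u 0%N + t * u 1%N)|.
      by rewrite opprD addrA subrr add0r normrN.
    by apply: cvg_norm; apply: cvgB; [exact: cv|exact: cvg_cst].
  apply: (cvgr_to_le cv'); near=> N.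
  have N1 : (1 < N)%N by near: N; exact: nbhs_infty_gt.
  rewrite /series /= big_ltn ?(ltnW N1) // big_ltn // expr0 expr1 mul1r.
  rewrite addrA [_ + \sum_(_ <= _ < _) _]addrC addrK.
  have le2 : \sum_(2 <= n < N) `|u n| <= B.
    apply: le_trans (ule N); rewrite [leRHS]big_ltn ?(ltnW N1) // big_ltn //.
    by rewrite addrA lerDr addr_ge0.
  rewrite (le_trans (ler_norm_sum _ _ _)) //.
  apply: (@le_trans _ _ (\sum_(2 <= n < N) t * (t * `|u n|))).
    rewrite big_nat_cond [leRHS]big_nat_cond; apply: ler_sum => n /andP[/andP[n2 _] _].
    rewrite normrM mulrA ler_wpM2r // ger0_norm ?exprn_ge0 ?(ltW t0) //.
    by rewrite -expr2 ler_wiXn2l // ltW.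
  by rewrite -!mulr_sumr !ler_wpM2l // ltW.
rewrite -u1; apply/eqP; rewrite -normr_le0; apply/ler_addgt0Pr => e e0.
(* This t makes [t * B] at most e; B + 1 keeps the denominator positive when B = 0. *)
rewrite add0r; pose t := Num.min 1 (e / (B + 1)).
have B1 : 0 < B + 1 by rewrite ltr_wpDl.
have t0 : 0 < t by rewrite lt_min ltr01 divr_gt0.
have t1 : t <= 1 by rewrite ge_min lexx.
apply: (le_trans (bound t t0 t1)).
have tle : t <= e / (B + 1) by rewrite ge_min lexx orbT.
apply: (le_trans (ler_wpM2r B0 tle)).
by rewrite mulrAC ler_pdivrMr // ler_pM2l // lerDl.
Unshelve. all: by end_near. Qed.

End ConstantOnPoints.

(** * Locally constant functions *)

Section Euler.
Variables (K : fieldType) (A : comHopfType K).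
Hypotheses (K0 : forall n, n.+1%:R != 0 :> K) (A_fg : finitely_generated A).

Local Notation m := (augm (@counit K A)).

(* The Euler derivation E = \sum_i y_i D_i, where the y_i are dual to the D_i,
   acts on m^n / m^(n+1) as multiplication by n. *)
Lemma constant_ipow w : m w ->
  (forall delta : {linear A -> K^o}, point_derivation (@counit K A) delta ->
     ract delta w = 0) ->
  forall n, ipow m n w.
Proof.
move=> mw Dw.
have [r [y [delta [my Hdelta ydelta]]]] := cotangent_basis (@counit K A) A_fg.
pose E a := \sum_i y i * ract (delta i) a.
have mul2 a b : m a -> m b -> ipow m 2 (a * b).
  by move=> /(ipow1 (@counit K A)) ma /(ipow1 (@counit K A)) mb; exact: ipow_mul ma mb.
have ED a b : E (a + b) = E a + E b.
  by rewrite /E -big_split; apply: eq_bigr => i _; rewrite raddfD mulrDr.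
have EM a b : E (a * b) = a * E b + E a * b.
  rewrite /E mulr_sumr mulr_suml -big_split; apply: eq_bigr => i _.
  by rewrite ract_derivation // mulrDr mulrCA [y i * (_ * _)]mulrA.
have E0 : E 0 = 0 by rewrite /E big1 // => i _; rewrite raddf0 mulr0.
have Em a : m (E a).
  rewrite /augm /E rmorph_sum big1 // => i _.
  by rewrite rmorphM /= my mul0r.
(* Modulo m, [D_i a] is its value [delta_i a] at the identity, and a is the sum of the
   [delta_i a *: y_i] modulo m^2. *)
have E1 a : m a -> ipow m 2 (E a - a).
  move=> ma; have := ydelta a; rewrite [counit a]ma scale0r subr0 => Ha.
  have -> : E a - a = \sum_i y i * (ract (delta i) a - (delta i a : K)%:A)
      - (a - \sum_i (delta i a : K) *: y i).
    rewrite /E; under [in RHS]eq_bigr do rewrite mulrBr mulr_algr.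
    by rewrite sumrB opprB addrA subrK.
  apply: ipowB => //; apply: ipow_sum => i; apply: mul2 => //.
  by rewrite -(counit_ract (delta i) a); exact: augm_sub.
have En n a : ipow m n a -> ipow m n.+1 (E a - a *+ n).
  elim=> [b|k x z mx Hz IH|k|k x z _ IHx _ IHz].
  - by rewrite subr0; apply/ipow1/Em.
  - have -> : E (x * z) - (x * z) *+ k.+1 =
        x * (E z - z *+ k) + (E x - x) * z.
      by rewrite EM mulrS mulrBr mulrBl -mulrnAr; ring.
    by apply: ipowD; [exact: ipowM|exact: (ipow_mul (E1 x mx) Hz)].
  - by rewrite E0 mul0rn subrr; exact: ipow_zero.
  - by rewrite ED mulrnDl opprD addrACA; exact: ipowD.
have Ew : E w = 0 by rewrite /E big1 // => i _; rewrite Dw ?mulr0.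
(* The Euler argument starts at exponent 1: as [E w = 0], [En] puts [(n + 1) w] in m^(n+2), and n +
   1 is invertible in K. *)
elim=> [|[|n] IH]; [exact: ipow0|exact/ipow1|].
have := En _ _ IH; rewrite Ew sub0r => /ipowN; rewrite opprK.
move=> /(ipow_scale (n.+1%:R)^-1).
by rewrite -scaler_nat scalerA mulVf // scale1r.
Qed.

End Euler.

Section LocallyConstant.
Variables (K : fieldType) (A : comHopfType K).

(* the comorphism of (g, h) |-> (g, g h) *)
Let shear : {lrmorphism A ⊗ A -> A ⊗ A} := tcopair (@tinl K A A) (@comul K A).

Let shearE a c : shear (a ⊗t c) = tinl A a * comul c.
Proof. exact: tcopairE. Qed.

(** The inverse map is (g, h) |-> (g, g^-1 h); its comorphism [U] sends a ⊗ c to the sum of the a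
    S(c_1) ⊗ c_2, with S the antipode. *)
Lemma shear_inj : injective shear.
Proof.
have ht := tens_is_bilinear A A.
have hf (a : A) : is_bilinear (fun x y : A => a * x * antipode y).
  split=> [y k u v|x k u v] /=.
    by rewrite mulrDr mulrDl -scalerAr -scalerAl.
  by rewrite linearP mulrDr -scalerAr.
have hg (a : A) : is_bilinear (fun y z : A => (a * antipode y) ⊗t z).
  split=> [z k u v|y k u v] /=; last by rewrite ht.2.
  by rewrite linearP mulrDr -scalerAr ht.1.
pose g (a : A) := tlin (hg a).
have gE a x y : g a (x ⊗t y) = (a * antipode x) ⊗t y by rewrite /g /= tliftE.
have gP a k u v : g a (k *: u + v) = k *: g a u + g a v by exact: linearP.
have cP k u v : comul (k *: u + v) = k *: comul u + comul v :> A ⊗ A.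
  exact: linearP.
have hU : is_bilinear (fun a c : A => g a (comul c)).
  split=> [c k u v|a k u v] /=; last first.
    exact: etrans (congr1 (g a) (cP k u v)) (gP a k _ _).
  rewrite /tlift /tsum scaler_sumr -big_split; apply: eq_bigr => p _.
  by rewrite mulrDl -scalerAl ht.1.
pose U := tlin hU.
have UE a c : U (a ⊗t c) = g a (comul c) by rewrite /U /= tliftE.
have Usum I (r : seq I) (H : I -> A ⊗ A) :
  U (\sum_(i <- r) H i) = \sum_(i <- r) U (H i) by exact: raddf_sum.
apply: (can_inj (g := U)).
elim/tensor_ind => [|a c x IH]; first by rewrite !raddf0.
have sD u v : shear (u + v) = shear u + shear v by exact: raddfD.
have UD u v : U (u + v) = U u + U v by exact: raddfD.
rewrite sD UD IH; congr (_ + _).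
have -> : shear (a ⊗t c) = \sum_(p <- repr (comul c)) (a * p.1) ⊗t p.2.
  rewrite shearE [in LHS](comul_sum c) mulr_sumr; apply: eq_bigr => p _.
  by rewrite tensM mul1r.
rewrite Usum.
transitivity (\sum_(p <- repr (comul c))
    tlift (fun x y => a * x * antipode y) (comul p.1) ⊗t p.2).
  rewrite -[RHS](comulA_bilinear c (hf a)); apply: eq_bigr => p _.
  by rewrite UE.
transitivity (a ⊗t (\sum_(p <- repr (comul c)) (counit p.1 : K) *: p.2)).
  rewrite tens_sumr; apply: eq_bigr => p _.
  have -> : tlift (fun x y => a * x * antipode y) (comul p.1) =
      (counit p.1 : K) *: a.
    rewrite -[RHS]mulr_algr -comul_antipoder /tlift /tsum mulr_sumr.
    by apply: eq_bigr => q _; rewrite mulrA.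
  by rewrite (bilinZl ht) (bilinZr ht).
by congr (_ ⊗t _); exact: comul_counitl.
Qed.

(** The function beta is (g, x) |-> b(g^-1 x): it becomes b(h) when x = g h, and b(1) on the
    diagonal. *)
Lemma shear_preimage b : exists2 beta : A ⊗ A,
  shear beta = tinr A b & tcopair (@idfun A) (@idfun A) beta = (counit b : K)%:A.
Proof.
have ht := tens_is_bilinear A A.
have hf : is_bilinear (fun x y : A => antipode x * y).
  split=> [y k u v|x k u v] /=.
    by rewrite linearP mulrDl -scalerAl.
  by rewrite mulrDr -scalerAr.
have ssum I (r : seq I) (H : I -> A ⊗ A) :
  shear (\sum_(i <- r) H i) = \sum_(i <- r) shear (H i) by exact: raddf_sum.
exists (\sum_(p <- repr (comul b)) antipode p.1 ⊗t p.2).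
  rewrite ssum.
  transitivity (\sum_(p <- repr (comul b))
      tlift (fun x y => antipode x * y) (comul p.1) ⊗t p.2).
    rewrite -[RHS](comulA_bilinear b hf); apply: eq_bigr => p _.
    rewrite shearE [in LHS](comul_sum p.2) mulr_sumr; apply: eq_bigr => q _.
    by rewrite tensM mul1r.
  transitivity ((1 : A) ⊗t (\sum_(p <- repr (comul b)) (counit p.1 : K) *: p.2)).
    rewrite tens_sumr; apply: eq_bigr => p _.
    by rewrite comul_antipodel (bilinZl ht) (bilinZr ht).
  by congr (_ ⊗t _); exact: comul_counitl.
rewrite raddf_sum -comul_antipodel; apply: eq_bigr => p _.
exact: tcopairE.
Qed.

(* If w vanishes near the identity, then w(x) = w(g) whenever g^-1 x is near the
   identity, hence near the diagonal: beta (1 ⊗ w) = beta (w ⊗ 1) with beta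
   equal to 1 on the diagonal. *)
Lemma locally_constant_regular n (w : 'I_n -> A) (rho : 'I_n -> 'I_n -> A) b :
  (forall i, comul (w i) = w i ⊗t 1 + \sum_k rho i k ⊗t w k) ->
  counit b = 1 -> (forall k, b * w k = 0) ->
  forall i, exists c, w i = w i * (w i * c).
Proof.
move=> cw b1 bw i; have [beta betaE multE] := shear_preimage b.
(* After the shear the difference reads (w_i(g h) - w_i(g)) b(h), a combination of the w_k(h) b(h) =
   0. *)
have E : tinr A (w i) * beta = tinl A (w i) * beta.
  apply: shear_inj; apply/eqP; rewrite -subr_eq0; apply/eqP.
  have sM u v : shear (u * v) = shear u * shear v by exact: rmorphM.
  rewrite !sM -mulrBl betaE [shear (tinr _ _)]shearE [shear (tinl _ _)]shearE.
  have -> : comul 1 = 1 :> A ⊗ A by exact: rmorph1.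
  have -> : tinl A 1 = 1 :> A ⊗ A by exact: rmorph1.
  rewrite mul1r mulr1 cw addrAC subrr add0r mulr_suml big1 // => k _.
  by rewrite tensM mulr1 [w k * b]mulrC bw (bilin0r (tens_is_bilinear A A)).
pose s := repr beta; pose x j := (tnth (in_tuple s) j).1.
pose y j := (tnth (in_tuple s) j).2.
have bE : beta = \sum_j x j ⊗t y j by rewrite {1}(tensor_sum beta) big_tnth.
have [phi phiE] := finite_rank_projection (fun j => w i * y j).
(* A linear substitute for division by [w i] on the span of the [w i * y j]. Applying a ⊗ c |-> a
   psi(c) to [E] and multiplying by [w i] gives [w i] on one side and a multiple of its square on
   the other. *)
pose psi (a : A) := \sum_k (phi k a : K) *: y k.
have psiE j : w i * psi (w i * y j) = w i * y j.
  by rewrite -[RHS]phiE mulr_sumr; apply: eq_bigr => k _; rewrite -scalerAr.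
have hP : is_bilinear (fun a c : A => a * psi c).
  split=> [c k u v|a k u v] /=; first by rewrite mulrDl -scalerAl.
  have -> : psi (k *: u + v) = k *: psi u + psi v.
    rewrite scaler_sumr -big_split; apply: eq_bigr => l _.
    by rewrite linearP scalerDl scalerA.
  by rewrite mulrDr -scalerAr.
pose P := tlin hP.
have PE a c : P (a ⊗t c) = a * psi c by rewrite /P /= tliftE.
have Psum (H : 'I_(size s) -> A ⊗ A) : P (\sum_j H j) = \sum_j P (H j).
  exact: raddf_sum.
exists (\sum_j x j * psi (y j)).
have multE' : \sum_j x j * y j = 1.
  transitivity (tcopair (@idfun A) (@idfun A) beta).
    by rewrite bE raddf_sum; apply: eq_bigr => j _; exact/esym/tcopairE.
  by rewrite multE b1 scale1r.
have F : \sum_j P (tinr A (w i) * (x j ⊗t y j)) =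
    \sum_j P (tinl A (w i) * (x j ⊗t y j)).
  by rewrite -!Psum -!mulr_sumr -bE E.
transitivity (w i * \sum_j P (tinr A (w i) * (x j ⊗t y j))).
  rewrite -{1}[w i]mulr1 -multE' !mulr_sumr; apply: eq_bigr => j _.
  by rewrite tensM mul1r PE [RHS]mulrCA psiE mulrCA.
rewrite F; congr (_ * _); rewrite mulr_sumr; apply: eq_bigr => j _.
by rewrite tensM mul1r PE mulrA.
Qed.

End LocallyConstant.

(** * Idempotents and connected components of the spectrum *)

(** Zorn's lemma is applied to the I with I + aA proper, so that a maximal one contains a; every
    element outside it is invertible modulo it, whence primality. *)
Lemma prime_ideal_exists (A : comNzRingType) (a : A) :
  (forall u, u * a <> 1) -> exists p : Spec A, a \in prime_of p.
Proof.
move=> au.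
pose ideal (I : set A) := forall c u v, I u -> I v -> I (c * u + v).
pose proper (I : set A) := forall u t, I t -> u * a + t <> 1.
have [|I [[Iid Iprop] Imax]] := @Zorn_bigcup A [set I | ideal I /\ proper I].
  move=> F FP Ftot; split=> [c u v [I FI Iu] [J FJ Jv]|u t [I FI It]].
    case: (Ftot I J FI FJ) => [IJ|JI].
      by exists J => //; apply: (FP J FJ).1 => //; exact: IJ.
    by exists I => //; apply: (FP I FI).1 => //; exact: JI.
  exact: (FP I FI).2.
have I0 : I 0.
  apply: contrapT => nI0; apply: (Imax [set 0]).
    split=> [t It|/(_ 0 erefl)//]; exfalso; apply: nI0.
    by have := Iid (-1) t t It It; rewrite mulN1r addNr.
  by split=> [c u v -> ->|u t ->]; rewrite ?mulr0 addr0 //; exact: au.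
have Imul c u : I u -> I (c * u) by move=> Iu; rewrite -[_ * _]addr0; exact: Iid.
have ext z : ~ I z -> exists u c t, I t /\ u * a + (c * z + t) = 1.
  move=> nz; apply: contrapT => nex.
  apply: (Imax [set t | exists c s, I s /\ t = c * z + s]).
    split=> [t It|sub]; first by exists 0, t; rewrite mul0r add0r.
    by apply: nz; apply: sub; exists 1, 0; rewrite mul1r addr0.
  split=> [c _ _ [d [s [Is ->]]] [d' [s' [Is' ->]]]|u _ [c [t [It ->]]] E].
    exists (c * d + d'), (c * s + s'); split; first exact: Iid.
    by ring.
  by apply: nex; exists u, c, t.
have Ia : I a.
  apply: contrapT => /ext[u [c [t [It E]]]].
  by apply: (Iprop (u + c) t It); rewrite mulrDl -addrA.
have H z : ~ I z -> exists c t, I t /\ c * z + t = 1.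
  move=> /ext[u [c [t [It E]]]]; exists c, (u * a + t); split; first exact: Iid.
  by rewrite addrCA.
have I1 : ~ I 1 by move=> /(Iprop 0); rewrite mul0r add0r.
pose p u := `[< I u >].
have pE u : reflect (I u) (u \in (p : {pred A})) by exact: asboolP.
have pid : idealr_closed p /\ prime_idealr_closed p.
  split; first split.
  - exact/pE.
  - exact/pE.
  - by move=> c u v /pE Iu /pE Iv; apply/pE; exact: Iid.
  move=> u v /pE Iuv; apply/orP; apply: contrapT => /not_orP[nu nv].
  have [c [t [It E1]]] := H u (fun Iu => nu (introT (pE u) Iu)).
  have [d [s [Is E2]]] := H v (fun Iv => nv (introT (pE v) Iv)).
  apply: I1; rewrite -[1]mulr1 -{1}E1 -E2.
  have -> : (c * u + t) * (d * v + s) =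
    (c * d) * (u * v) + ((c * u) * s + ((d * v + s) * t + 0)) by ring.
  by apply: (Iid) => //; apply: (Iid) => //; exact: Iid.
exists (exist _ p pid).
exact/pE.
Qed.

(** If e is nonzero, 1 - e is not invertible and lies in a prime p. The locus where e is not in the
    prime is open and closed and contains p, hence also a rational point of its component, at which
    e vanishes: a contradiction. *)
Lemma idempotent_eq0 (K : fieldType) (A : comAlgType K) (e : A) :
  without_imaginary_components A -> e * e = e ->
  (forall x : rational_point A, x e = 0) -> e = 0.
Proof.
move=> Acomp ee e0; apply: contrapT => ne0.
have [|p pe] := @prime_ideal_exists A (1 - e).
  move=> u ue; apply: ne0; rewrite -[e]mul1r -ue -mulrA mulrBl mul1r ee subrr.
  by rewrite mulr0.
have [x [D [Dp _ Dcon] Dx]] := Acomp p.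
pose V : set (Spec A) := [set q | e \notin prime_of q].
have VE : V = [set q | 1 - e \in prime_of q].
  apply/seteqP; split=> q /=.
    case: q => q [[q0 q1 qid] qpr]; rewrite /V /prime_of /= => eq.
    have := qpr e (1 - e); rewrite mulrBr mulr1 ee subrr => /(_ q0).
    by rewrite (negbTE eq).
  case: q => q [[q0 q1 qid] qpr]; rewrite /V /prime_of /= => eq.
  apply/negP => qe; move/negP: q1; apply.
  by have := qid 1 (1 - e) e eq qe; rewrite mul1r subrK.
have Vopen : open V.
  rewrite Spec_openE; exists [set e]; apply/seteqP; split=> q /=.
    by move=> qe /(_ e erefl) qe'; move: qe; rewrite /V /= qe'.
  by move=> qe; apply/negP => qe'; apply: qe => _ ->.
have Vclosed : closed V.
  rewrite -openC Spec_openE VE; exists [set 1 - e]; congr (~` _).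
  by apply/seteqP; split=> q /= => [qe _ ->|]; [|exact].
have Vp : V p by rewrite VE.
have : D `&` V = D by apply: Dcon; [exists p|exists V|exists V].
move=> /seteqP[_ /(_ _ Dx)[_]]; rewrite /V /= /prime_of /= inE.
by rewrite e0 eqxx.
Qed.

Theorem corollary2p2 (R : realType) (A : comHopfType R)
    (A_fg : finitely_generated A)
    (A_comp : without_imaginary_components A)
    (E : vectType R) (rho : representation A E) :
  invariants rho = rational_invariants rho.
Proof.
apply/seteqP; split; first exact: invariants_sub.
move=> v vinv; apply/invariantsP => i0.
pose x j : R := coord (rep_basis rho) j v.
pose c i := \sum_j x j *: rep_mx rho i j.
pose w i := c i - (x i)%:A.
have gc (g : rational_point A) i : g (c i) = x i.
  have := congr1 (coord (rep_basis rho) i) (vinv g).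
  rewrite /rep_at coord_sum_free ?(basis_free (rep_basisP rho)) // => H.
  apply: etrans H.
  rewrite linear_sum; apply: eq_bigr => j _.
  by rewrite linearZ; exact: mulrC.
have gw (g : rational_point A) i : g (w i) = 0.
  by rewrite rmorphB /= gc rational_pointA subrr.
have ht := tens_is_bilinear A A.
have cc i : comul (c i) = \sum_k rep_mx rho i k ⊗t c k.
  rewrite linear_sum; under [RHS]eq_bigr do rewrite tens_sumr.
  rewrite exchange_big; apply: eq_bigr => j _.
  rewrite linearZ /= comul_rep_mx scaler_sumr; apply: eq_bigr => k _.
  by rewrite (bilinZr ht).
have cw i : comul (w i) = w i ⊗t 1 + \sum_k rep_mx rho i k ⊗t w k.
  have -> : \sum_k rep_mx rho i k ⊗t w k = comul (c i) - c i ⊗t 1.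
    rewrite cc {2}/c tens_suml -sumrB; apply: eq_bigr => k _.
    rewrite /w (bilinDr ht) -scaleN1r !(bilinZr ht) (bilinZl ht) scaleN1r.
    by [].
  have -> : w i ⊗t (1 : A) = c i ⊗t (1 : A) - x i *: 1.
    by rewrite -[LHS]/(tinl A (w i)) raddfB /= linearZ /= rmorph1.
  have -> : comul (w i) = comul (c i) - x i *: 1.
    by rewrite raddfB /= linearZ /= rmorph1.
  by rewrite [RHS]addrC addrA subrK.
(* By [cc], [D (c i)] is a combination of the [delta (c k)]. They vanish because [c k] takes the
   value [x k] at all rational points, [counit] included. *)
have Dw i (delta : {linear A -> R^o}) : point_derivation (@counit R A) delta ->
    ract delta (w i) = 0.
  move=> Hdelta.
  have dc k : delta (c k) = 0.
    by apply: point_derivation_eq0 => // g; rewrite !gc.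
  rewrite linearB linearZ /= ract1 // scaler0 subr0.
  transitivity (tlin (ract_bilinear A delta) (comul (c i))) => //.
  rewrite cc raddf_sum big1 // => k _.
  by rewrite [LHS]tliftE ?dc ?scale0r //; exact: ract_bilinear.
have R0 n : n.+1%:R != 0 :> R by rewrite pnatr_eq0.
have wpow i := constant_ipow R0 A_fg (gw (@counit R A) i) (Dw i).
have /choice[b bP] i : exists b, counit b = 1 /\ b * w i = 0.
  by have [b b1 bw] := krull_intersection A_fg (wpow i); exists b.
(* The product is a single function with value 1 at the identity that kills all the [w i] at
   once. *)
have [||y yE] := locally_constant_regular (b := \prod_i b i) cw _ _ i0.
- by rewrite rmorph_prod big1 // => i _; case: (bP i).
- by move=> k; rewrite (bigD1 k) //= mulrAC (bP k).2 mul0r.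
(* From [w = w (w y)] it follows that [w y] is idempotent, and it vanishes at the rational points
   along with w. *)
have wy0 : w i0 * y = 0.
  apply: (idempotent_eq0 A_comp) => [|g].
    by rewrite mulrACA mulrA -[w i0 * w i0 * y]mulrA -yE.
  by rewrite rmorphM /= gw mul0r.
have w0 : w i0 = 0 by rewrite yE wy0 mulr0.
apply/eqP; rewrite -subr_eq0 -[X in _ == X]w0; apply/eqP; congr (_ - _).
by apply: eq_bigr => j _; rewrite mulr_algr.
Qed.
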